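(* Let $\phi:(\tilde G\rightrightarrows\tilde M,\tilde\eta)\to(G\rightrightarrows M,\eta)$ be a Riemannian Morita map between Riemannian groupoids. Then the induced map $\bar\phi:\tilde M/\tilde G\to M/G$ between the coarse orbit spaces preserves the normal pseudo-distance: $d_N(\bar\phi([x]),\bar\phi([y]))=d_N([x],[y])$ for all $x,y\in\tilde M$.
   Context: Lie groupoids: $G\rightrightarrows M$ has manifolds $M$ of objects and $G$ of arrows ($G$ possibly non-Hausdorff), surjective submersions $s,t:G\to M$ (source, target), a smooth multiplication $m$ on $G^{(2)}=\{(g,h):s(g)=t(h)\}$, units and inverses. $O_x\subset M$ is the orbit of $x$, $G_x=s^{-1}(x)\cap t^{-1}(x)$ the isotropy group, $M/G$ the coarse orbit space with the quotient topology, $[x]\in M/G$ the class of $x$, and $N_xO=T_xM/T_xO_x$. A map of Lie groupoids $f:(H\rightrightarrows N)\to(G\rightrightarrows M)$ is a smooth functor; it induces $[f]:N/H\to M/G$, $f_x:H_x\to G_{f(x)}$ and $[d_xf]:N_xO\to N_{f(x)}O$. It is Morita if $[f]$ is a homeomorphism and all $f_x$ and $[d_xf]$ are isomorphisms. Riemannian groupoids: a metric on the total space of a submersion is transverse to the submersion if it descends to a metric on the base making it a Riemannian submersion. A groupoid metric on $G\rightrightarrows M$ is a Riemannian metric $\eta=\eta^{(2)}$ on $G^{(2)}$, invariant under the $S_3$-action that permutes the vertices of commutative triangles (generated by $(g,h)\mapsto(h^{-1},g^{-1})$ and $(g,h)\mapsto(gh,h^{-1})$), and transverse to $m$. It induces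 metrics $\eta^{(1)}$ on $G$ and $\eta^{(0)}$ on $M$ for which $m$ and the two projections $G^{(2)}\to G$, and $s,t:G\to M$, are Riemannian submersions. A Riemannian groupoid is a Lie groupoid with a groupoid metric. $\eta^{(0)}$ induces inner products on the spaces $N_xO\cong (T_xO_x)^\perp$. A Riemannian Morita map is a Morita map between Riemannian groupoids such that all $[d_xf]:N_xO\to N_{f(x)}O$ are isometries. Normal pseudo-distance: let $d$ be the Riemannian distance of $\eta^{(0)}$ on each component of $M$. A chain from $x$ to $y$ is a sequence $(x_0,\dots,x_{2n+1})$ in $M$ with $x_0=x$, $x_{2n+1}=y$, $x_{2i},x_{2i+1}$ in the same orbit, and $x_{2i-1},x_{2i}$ in the same component of $M$. Then $d_N([x],[y])=\inf\{\sum_{i=1}^n d(x_{2i-1},x_{2i})\}$ over all chains from $x$ to $y$ (with value $+\infty$ if there is no chain, which does not happen when $M/G$ is connected). *)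

(* Defs.v *)
From HB Require Import structures.
From mathcomp Require Import all_boot all_order all_algebra.
From mathcomp Require Import all_classical all_reals all_analysis.

Set Implicit Arguments.
Unset Strict Implicit.
Unset Printing Implicit Defensive.
Import Order.TTheory GRing.Theory Num.Theory.
Import numFieldNormedType.Exports.

Local Open Scope classical_set_scope.
Local Open Scope ring_scope.
Local Open Scope quotient_scope.

(* Only meaningful when [U] is open: all conditions are pointwise on [U]. *)
Fixpoint Ck (R : realType) (V W : normedModType R) (k : nat) (U : set V)
    (f : V -> W) : Prop :=
  match k with
  | 0 => {in U, continuous f}
  | k'.+1 => (forall x, U x -> differentiable f x) /\
             (forall v, Ck k' U (fun x => 'D_v f x))
  end.

Definition smooth_on (R : realType) (V W : normedModType R) (U : set V)
    (f : V -> W) : Prop := forall k, Ck k U f.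

(* [cinv] is total; only its values on the open set [cfun @` cdom] matter. *)
Record chart (R : realType) (T : topologicalType) (n : nat) := Chart {
  cdom : set T;
  cfun :> T -> 'rV[R]_n;
  cinv : 'rV[R]_n -> T;
  cdom_open : open cdom;
  cimg_open : open (cfun @` cdom);
  cfunK : {in cdom, cancel cfun cinv};
  cfun_continuous : {in cdom, continuous cfun};
  cinv_continuous : {in cfun @` cdom, continuous cinv}
}.

(* Besides a smooth atlas, a chart [chart_at x] around each point is singled
   out.  It serves to represent tangent vectors: the tangent space at [x] is
   'rV[R]_n, a vector being identified with its coordinates in [chart_at x]. *)
Record smooth_structure (R : realType) (T : topologicalType) :=
  SmoothStructure {
  sdim : nat;
  atlas : set (chart R T sdim);
  chart_at : T -> chart R T sdim;
  chart_at_atlas : forall x, atlas (chart_at x);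
  chart_at_dom : forall x, cdom (chart_at x) x;
  atlas_smooth : forall c c', atlas c -> atlas c' ->
    smooth_on (c @` (cdom c `&` cdom c')) (c' \o cinv c)
}.

Arguments sdim {R T} _.
Arguments atlas {R T} _ _.
Arguments chart_at {R T} _ _.

(* Hausdorffness and second countability are not part of this record; they are
   required in [lie_groupoid] below. *)
Record manifold (R : realType) := Manifold {
  msort :> topologicalType;
  mstr : smooth_structure R msort
}.

Notation mdim M := (sdim (mstr M)).
Notation matlas M := (atlas (mstr M)).
Notation mchart M := (chart_at (mstr M)).
Notation "''T' M" := 'rV_(mdim M) (at level 8, M at level 2).

Section SmoothMaps.
Context {R : realType}.
Implicit Types M N : manifold R.

Definition smooth_map_on M N (W : set M) (f : M -> N) : Prop :=
  {in W, continuous f} /\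
  forall c c', matlas M c -> matlas N c' ->
    smooth_on (c @` (cdom c `&` W `&` f @^-1` cdom c')) (c' \o f \o cinv c).

Definition smooth_map M N (f : M -> N) : Prop := smooth_map_on setT f.

(* The map is smooth on an arbitrary subset [S] when it extends locally to a
   smooth map; if [S] is an embedded submanifold this is smoothness on the
   manifold [S]. *)
Definition smooth_map_subset M N (S : set M) (f : M -> N) : Prop :=
  forall x, S x -> exists (W : set M) (F : M -> N),
    [/\ open W, W x, smooth_map_on W F & {in W `&` S, F =1 f}].

Definition tangent_map M N (f : M -> N) (x : M) : 'Hom('T M, 'T N) :=
  linfun ('d (mchart N (f x) \o f \o cinv (mchart M x)) (mchart M x x)).

Definition submersion M N (f : M -> N) : Prop :=
  smooth_map f /\ forall x, limg (tangent_map f x) = fullv.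

Definition smooth_curve M (c : R -> M) : Prop :=
  continuous c /\
  forall h, matlas M h -> smooth_on (c @^-1` cdom h) (h \o c : R^o -> 'T M).

(* The curve [c] is only relevant on the interval [0, 1]. *)
Definition piecewise_smooth M (c : R -> M) : Prop :=
  exists2 s : seq R, itv_partition 0 1 s &
    forall i : nat, (i < size s)%N ->
      exists2 e : R -> M, smooth_curve e &
        {in `[nth 0 (0 :: s) i, nth 0 (0 :: s) i.+1], c =1 e}.

Definition velocity M (c : R -> M) (t : R) : 'T M :=
  derive1 (fun u : R => mchart M (c t) (c u)) t.

Record rmetric M := RMetric {
  ip :> M -> 'T M -> 'T M -> R;
  ip_linear : forall x (a : R) (u v w : 'T M), ip x (a *: u + v) w = a * ip x u w + ip x v w;
  ip_sym : forall x (v w : 'T M), ip x v w = ip x w v;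
  ip_pos : forall x (v : 'T M), v != 0 -> 0 < ip x v v;
  (* the coefficients in a chart [c] are smooth; the differential of the
     change of coordinates converts from [c] to the preferred chart *)
  ip_smooth : forall c (v w : 'T M), matlas M c ->
    smooth_on (c @` cdom c) (fun y : 'T M =>
      let x := cinv c y in
      let J := 'd (mchart M x \o cinv c) y in
      ip x (J v) (J w) : R^o)
}.

Definition orthogonal_to M (g : rmetric M) (x : M) (U : {vspace 'T M})
  : set ('T M) := [set v | forall u, u \in U -> g x v u = 0].

Definition riemannian_submersion M N (gM : rmetric M) (gN : rmetric N)
    (f : M -> N) : Prop :=
  submersion f /\
  forall x v w,
    orthogonal_to gM x (lker (tangent_map f x)) v ->
    orthogonal_to gM x (lker (tangent_map f x)) w ->
    gN (f x) (tangent_map f x v) (tangent_map f x w) = gM x v w.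

Definition metric_preserving M N (gM : rmetric M) (gN : rmetric N)
    (f : M -> N) : Prop :=
  forall x v w,
    gN (f x) (tangent_map f x v) (tangent_map f x w) = gM x v w.

Definition curve_length M (g : rmetric M) (c : R -> M) : \bar R :=
  (\int[lebesgue_measure]_(t in `[0%R, 1%R])
     (Num.sqrt (g (c t) (velocity c t) (velocity c t)))%:E)%E.

(* The value is +oo when [x] and [y] lie in different components. *)
Definition riemannian_dist M (g : rmetric M) (x y : M) : \bar R :=
  ereal_inf [set curve_length g c | c in
    [set c | [/\ piecewise_smooth c, c 0 = x & c 1 = y]]].

End SmoothMaps.

Section ComposablePairs.
Context {R : realType} {A M : manifold R} (s t : A -> M).

(* [set_type] carries the subspace topology of A * A *)
Definition comp_pairs : topologicalType :=
  set_type [set p : A * A | s p.1 = t p.2].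

Definition comp_pair g h (e : s g = t h) : comp_pairs :=
  exist _ (g, h) (mem_set (e : [set p : A * A | s p.1 = t p.2] (g, h))).

Definition comp_fst (p : comp_pairs) : A := (set_val p).1.
Definition comp_snd (p : comp_pairs) : A := (set_val p).2.

Lemma comp_pairsP (p : comp_pairs) : s (comp_fst p) = t (comp_snd p).
Proof. exact: (set_valP p). Qed.

End ComposablePairs.

Record lie_groupoid (R : realType) := LieGroupoid {
  obj : manifold R;
  arr : manifold R;
  src : arr -> obj;
  tgt : arr -> obj;
  comp_str : smooth_structure R (comp_pairs src tgt);
  gmul : comp_pairs src tgt -> arr;
  gunit : obj -> arr;
  ginv : arr -> arr;

  (* the arrow manifold may be non-Hausdorff *)
  obj_hausdorff : hausdorff_space obj;
  obj_countable : @second_countable obj;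
  arr_countable : @second_countable arr;

  (* [comp_str] is the structure of embedded submanifold of arr * arr: the
     inclusion is a topological embedding by definition of [comp_pairs], and
     it is a smooth immersion *)
  comp_fst_smooth : @smooth_map R (Manifold comp_str) arr (@comp_fst R _ _ src tgt);
  comp_snd_smooth : @smooth_map R (Manifold comp_str) arr (@comp_snd R _ _ src tgt);
  comp_immersion : forall p : Manifold comp_str,
    (lker (@tangent_map R (Manifold comp_str) arr (@comp_fst R _ _ src tgt) p) :&:
     lker (@tangent_map R (Manifold comp_str) arr (@comp_snd R _ _ src tgt) p)
       = 0)%VS;

  src_submersion : submersion src;
  tgt_submersion : submersion tgt;
  gmul_smooth : @smooth_map R (Manifold comp_str) arr gmul;
  gunit_smooth : smooth_map gunit;
  ginv_smooth : smooth_map ginv;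

  src_gunit : forall x, src (gunit x) = x;
  tgt_gunit : forall x, tgt (gunit x) = x;
  src_gmul : forall p, src (gmul p) = src (comp_snd p);
  tgt_gmul : forall p, tgt (gmul p) = tgt (comp_fst p);
  gmul_unitl : forall g (e : src (gunit (tgt g)) = tgt g), gmul (comp_pair e) = g;
  gmul_unitr : forall g (e : src g = tgt (gunit (src g))), gmul (comp_pair e) = g;
  gmulA : forall g h k (egh : src g = tgt h) (ehk : src h = tgt k)
      (egh_k : src (gmul (comp_pair egh)) = tgt k)
      (eg_hk : src g = tgt (gmul (comp_pair ehk))),
    gmul (comp_pair egh_k) = gmul (comp_pair eg_hk);
  src_ginv : forall g, src (ginv g) = tgt g;
  tgt_ginv : forall g, tgt (ginv g) = src g;
  gmul_invl : forall g (e : src (ginv g) = tgt g),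
    gmul (comp_pair e) = gunit (src g);
  gmul_invr : forall g (e : src g = tgt (ginv g)),
    gmul (comp_pair e) = gunit (tgt g)
}.

Section GroupoidTheory.
Context {R : realType} (G : lie_groupoid R).

Definition comp_manifold : manifold R := Manifold (comp_str G).

Definition triangle_swap (p : comp_manifold) : comp_manifold.
Proof.
refine (@comp_pair R _ _ _ _ (ginv (comp_snd p)) (ginv (comp_fst p)) _).
by rewrite src_ginv tgt_ginv; exact: esym (comp_pairsP p).
Defined.

Definition triangle_shift (p : comp_manifold) : comp_manifold.
Proof.
refine (@comp_pair R _ _ _ _ (gmul p) (ginv (comp_snd p)) _).
by rewrite src_gmul tgt_ginv.
Defined.

Definition orbit_rel : rel (obj G) :=
  fun x y => `[< exists g : arr G, src g = x /\ tgt g = y >].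

Lemma orbit_rel_refl : reflexive orbit_rel.
Proof.
by move=> x; apply/asboolP; exists (gunit x); rewrite src_gunit tgt_gunit.
Qed.

Lemma orbit_rel_sym : symmetric orbit_rel.
Proof.
move=> x y; apply/asboolP/asboolP => -[g [<- <-]]; exists (ginv g);
  by rewrite src_ginv tgt_ginv.
Qed.

Lemma orbit_rel_trans : transitive orbit_rel.
Proof.
move=> y x z /asboolP[g [sg tg]] /asboolP[h [sh th]]; apply/asboolP.
have e : src h = tgt g by rewrite sh tg.
by exists (gmul (comp_pair e)); rewrite src_gmul tgt_gmul.
Qed.

Canonical orbit_equiv :=
  EquivRel orbit_rel orbit_rel_refl orbit_rel_sym orbit_rel_trans.

Definition orbit_space : topologicalType :=
  quotient_topology {eq_quot orbit_equiv}.

Definition orbit_class (x : obj G) : orbit_space := \pi_{eq_quot orbit_equiv} x.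
Definition orbit_repr (q : orbit_space) : obj G :=
  repr (q : {eq_quot orbit_equiv}).

Lemma orbit_classP (x y : obj G) :
  orbit_class x = orbit_class y <-> orbit_rel x y.
Proof. by split => [/eqmodP|/eqmodP]. Qed.

Lemma orbit_reprK : cancel orbit_repr orbit_class.
Proof. by move=> q; exact: reprK. Qed.

Definition isotropy (x : obj G) : set (arr G) :=
  [set g | src g = x /\ tgt g = x].

(* T_x O_x: the orbit is the image of the constant rank map [tgt] restricted to
   the source fibre of [x], whose tangent space at the unit of [x] is the kernel
   of the differential of [src].  The differential of [tgt] takes values in the
   tangent space at tgt (gunit x) = x. *)
Definition orbit_tangent (x : obj G) : {vspace 'T (obj G)} :=
  (tangent_map (@tgt R G) (gunit x) @:
     lker (tangent_map (@src R G) (gunit x)))%VS.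

Definition normal_quotient (x : obj G) : zmodType :=
  Quotient.quot (pred_of_vspace (orbit_tangent x)).
Definition normal_class (x : obj G) (v : 'T (obj G)) : normal_quotient x :=
  \pi_(Quotient.quot (pred_of_vspace (orbit_tangent x))) v.
Definition normal_repr (x : obj G) (q : normal_quotient x) : 'T (obj G) :=
  repr (q : Quotient.quot (pred_of_vspace (orbit_tangent x))).

End GroupoidTheory.

Record groupoid_map (R : realType) (H G : lie_groupoid R) := GroupoidMap {
  fobj : obj H -> obj G;
  farr : arr H -> arr G;
  fobj_smooth : smooth_map fobj;
  farr_smooth : smooth_map farr;
  farr_src : forall g, src (farr g) = fobj (src g);
  farr_tgt : forall g, tgt (farr g) = fobj (tgt g);
  farr_gunit : forall x, farr (gunit x) = gunit (fobj x);
  farr_gmul : forall g h (e : src g = tgt h) (e' : src (farr g) = tgt (farr h)),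
    farr (gmul (comp_pair e)) = gmul (comp_pair e')
}.

Definition homeomorphism (X Y : topologicalType) (f : X -> Y) : Prop :=
  continuous f /\
  exists g : Y -> X, [/\ cancel f g, cancel g f & continuous g].

Section MoritaMaps.
Context {R : realType} {H G : lie_groupoid R} (f : groupoid_map H G).

Definition orbit_map (q : orbit_space H) : orbit_space G :=
  orbit_class (fobj f (orbit_repr q)).

Lemma orbit_mapE (x : obj H) : orbit_map (orbit_class x) = orbit_class (fobj f x).
Proof.
apply/orbit_classP.
have /orbit_classP/asboolP[g [sg tg]] := orbit_reprK (orbit_class x).
apply/asboolP.
by exists (farr f g); rewrite farr_src farr_tgt sg tg.
Qed.

(* Isomorphism of Lie groups: the inverse bijection is smooth, where G_x has the
   structure of embedded submanifold of the manifold of arrows. *)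
Definition isotropy_isomorphism (x : obj H) : Prop :=
  set_bij (isotropy x) (isotropy (fobj f x)) (farr f) /\
  exists2 k : arr G -> arr H,
    {in isotropy x, cancel (farr f) k} &
    smooth_map_subset (isotropy (fobj f x)) k.

Definition normal_map (x : obj H) (q : normal_quotient x)
  : normal_quotient (fobj f x) :=
  normal_class (fobj f x) (tangent_map (fobj f) x (normal_repr q)).

(* a bijection [normal_map] is a linear isomorphism, being induced by a linear
   map *)
Definition morita : Prop :=
  [/\ homeomorphism orbit_map,
      forall x, isotropy_isomorphism x &
      forall x, bijective (@normal_map x)].

End MoritaMaps.

(* A metric [eta2] on the composable pairs, invariant under the S_3-action and
   transverse to the multiplication, together with the metrics that it induces
   on arrows and objects.  As multiplication and source are surjective,
   [eta1] and [eta0] are determined by [eta2], and they always exist; the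
   remaining structure maps are then Riemannian submersions as well, being
   obtained from these two by composition with the isometries of the action. *)
Record groupoid_metric (R : realType) (G : lie_groupoid R) := GroupoidMetric {
  eta2 : rmetric (comp_manifold G);
  eta1 : rmetric (arr G);
  eta0 : rmetric (obj G);
  eta2_swap : metric_preserving eta2 eta2 (@triangle_swap R G);
  eta2_shift : metric_preserving eta2 eta2 (@triangle_shift R G);
  eta1_gmul : riemannian_submersion eta2 eta1
                (@gmul R G : comp_manifold G -> arr G);
  eta0_src : riemannian_submersion eta1 eta0 (@src R G)
}.

Section NormalDistance.
Context {R : realType} {G : lie_groupoid R} (eta : groupoid_metric G).
Local Notation M := (obj G).

(* component of [v] in (T_x O_x)^perp *)
Definition perp_part (x : M) (v : 'T M) : 'T M :=
  xget 0 [set w | orthogonal_to (eta0 eta) x (orbit_tangent x) w /\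
                  v - w \in orbit_tangent x].

(* inner product carried over by the isomorphism N_x O = (T_x O_x)^perp *)
Definition normal_ip (x : M) (p q : normal_quotient x) : R :=
  eta0 eta x (perp_part x (normal_repr p)) (perp_part x (normal_repr q)).

Definition chain (n : nat) (c : nat -> M) (x y : M) : Prop :=
  [/\ c 0%N = x, c n.*2.+1 = y,
      forall i, (i <= n)%N -> orbit_rel (c i.*2) (c i.*2.+1) &
      forall i, (1 <= i <= n)%N ->
        connected_component setT (c i.*2.-1) (c i.*2)].

Definition chain_dist (x y : M) : \bar R :=
  ereal_inf [set l | exists n c, chain n c x y /\
    l = (\sum_(1 <= i < n.+1)
           riemannian_dist (eta0 eta) (c i.*2.-1) (c i.*2))%E].

Definition normal_dist (p q : orbit_space G) : \bar R :=
  chain_dist (orbit_repr p) (orbit_repr q).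

Lemma chain_dist_orbit (x x' y y' : M) :
  orbit_rel x x' -> orbit_rel y y' -> (chain_dist x y <= chain_dist x' y')%E.
Proof.
move=> xx' yy'; apply: ereal_inf_le_tmp => l [n [c [[c0 cn co cc] ->]]].
pose c' i := if i == 0%N then x else if i == n.*2.+1 then y else c i.
have c'E i : (0 < i)%N -> (i < n.*2.+1)%N -> c' i = c i.
  by rewrite /c'; case: i => // i _ /ltn_eqF ->.
exists n, c'; split; last first.
  apply: eq_big_nat => i /andP[i0 ile].
  have i2 : (0 < i.*2.-1)%N by case: i i0 {ile}.
  have i3 : (i.*2 < n.*2.+1)%N by rewrite ltnS leq_double.
  by rewrite !c'E ?double_gt0// (leq_ltn_trans (leq_pred _)).
split => [||i ile|i /andP[i0 ile]].
- by rewrite /c'.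
- by rewrite /c' eqxx.
- have := co _ ile.
  have -> : c' i.*2.+1 = if i == n then y else c i.*2.+1.
    by rewrite /c' /= eqSS -!muln2 eqn_pmul2r.
  have -> : c' i.*2 = if i == 0%N then x else c i.*2.
    rewrite /c' double_eq0; case: ifP => // _; case: eqP => // e.
    by have := congr1 odd e; rewrite /= !odd_double.
  have [i0|i0] := eqVneq i 0%N; have [ien|ien] := eqVneq i n => // cio.
  + apply: (orbit_rel_trans (y := x')) => //.
    apply: (orbit_rel_trans (y := y')); last by rewrite orbit_rel_sym.
    by move: cio; rewrite ien cn -ien i0 c0.
  + by apply: (orbit_rel_trans xx'); rewrite -c0 -[0%N]/(0.*2)%N -i0.
  + apply: (orbit_rel_trans (y := y')); last by rewrite orbit_rel_sym.
    by rewrite -cn -ien.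
- have i2 : (0 < i.*2.-1)%N by case: i i0 {ile}.
  have i3 : (i.*2 < n.*2.+1)%N by rewrite ltnS leq_double.
  rewrite !c'E ?double_gt0//; last by rewrite (leq_ltn_trans (leq_pred _)).
  by apply: cc; rewrite i0.
Qed.

Lemma normal_distE (x y : M) :
  normal_dist (orbit_class x) (orbit_class y) = chain_dist x y.
Proof.
have reprP z : orbit_rel (orbit_repr (orbit_class z)) z.
  by apply/orbit_classP; exact: orbit_reprK.
by apply/eqP; rewrite eq_le !chain_dist_orbit // orbit_rel_sym.
Qed.

End NormalDistance.

Definition riemannian_morita (R : realType) (H G : lie_groupoid R)
    (etaH : groupoid_metric H) (etaG : groupoid_metric G)
    (f : groupoid_map H G) : Prop :=
  morita f /\
  forall x (p q : normal_quotient x),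
    normal_ip etaG (normal_map f p) (normal_map f q) = normal_ip etaH p q.

(* Main.v *)
Require Import Defs.
From HB Require Import structures.
From mathcomp Require Import all_boot all_order all_algebra.
From mathcomp Require Import all_classical all_reals all_analysis.
From mathcomp Require Import measurable_realfun.
From mathcomp Require Import zify ring lra.

Set Implicit Arguments.
Unset Strict Implicit.
Unset Printing Implicit Defensive.
Import Order.TTheory GRing.Theory Num.Theory.
Import numFieldNormedType.Exports.

Local Open Scope classical_set_scope.
Local Open Scope ring_scope.

(** Write [phi] for the Riemannian Morita map.  The normal pseudo-distance is
    the greatest function [E] of two points which satisfies the triangle
    inequality, is nonpositive on pairs in one orbit, and is bounded above by
    the Riemannian distance ([chain_dist_greatest]).  Hence each of the two
    inequalities to be proved says that a function [E] has these three
    properties: [E x y] is the pseudo-distance from [phi x] to [phi y] for one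
    of them, and the pseudo-distance from [psi x] to [psi y] for the other,
    where [psi y] is a point that [phi] sends into the orbit of [y].  The first
    two properties are immediate, as [phi] induces a bijection of orbits.

    The bound by the Riemannian distance is infinitesimal
    ([le_riemannian_dist]): it suffices that along each smooth curve [e], at
    each time [t] and for each [r > 0], both [E (e t) (e u)] and
    [E (e u) (e t)] are at most [(speed of e at t + r) * |u - t|] for [u] near
    [t].  This is where the metrics enter, since moving along an orbit is free
    and only the component of the velocity normal to the orbit has to be paid
    for.

    - Pushing a curve forward ([push_curve]).  Let [v] be the velocity of [e] at
      [t].  As the map of normal spaces is isometric, some vector [w] at
      [phi (e t)] is no longer than [v] and differs from [d phi v] by a vector
      tangent to the orbit ([push_normal]).  Then a vector at the unit arrow of
      [phi (e t)] has image [d phi v] under the source map and [w] under the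
      target map ([unit_lift]).  The curve [phi (e u)] lifts through the source
      map to arrows that leave the unit in this direction.  Their targets stay
      in the orbits of [phi (e u)], and leave [phi (e t)] with velocity [w].

    - Pulling a curve back ([pull_curve]).  Let [a] be an arrow from [e t] to
      [phi xt].  The velocity of [e] is first carried along [a] without gain of
      norm ([src_lift], a consequence of the invariance of the metric), then
      pulled back by the isometry of normal spaces to a vector [w] at [xt]
      ([pull_normal]).  The equations phi(x) = s(k), t(k) = t(b), s(b) = e u, for
      a point [x] and arrows [k], [b] near [xt], the unit of [phi xt] and [a],
      have a surjective differential because [d phi] is onto the normal spaces
      ([pull_system_surj]).  So they can be solved to first order in the
      direction [w], which yields a point [x] near [xt] that [phi] maps into
      the orbit of [e u].

    Only a first-order expansion of these solutions is used.  This permits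
    solving the equations by a contraction argument at each time separately
    ([strict_lift]), with no regularity of the solutions in [u], and moving from
    the base point to the solution along a segment in a chart
    ([chain_dist_chart]). *)

(** * Identities in modules *)
Section ModuleExpressions.
Variables (R : comNzRingType) (V : lmodType R).

Inductive mexp :=
  MVar of nat | MZero | MAdd of mexp & mexp | MOpp of mexp | MScale of R & mexp.

Fixpoint meval (env : seq V) e : V :=
  match e with
  | MVar n => nth 0 env n
  | MZero => 0
  | MAdd a b => meval env a + meval env b
  | MOpp a => - meval env a
  | MScale r a => r *: meval env a
  end.

Fixpoint mcoef e (i : nat) : R :=
  match e with
  | MVar n => if n == i then 1 else 0
  | MZero => 0
  | MAdd a b => mcoef a i + mcoef b i
  | MOpp a => - mcoef a i
  | MScale r a => r * mcoef a i
  end.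

Fixpoint same_coefs e1 e2 (i k : nat) : Prop :=
  if k is k'.+1 then mcoef e1 i = mcoef e2 i /\ same_coefs e1 e2 i.+1 k'
  else True.

(** The normal form of an expression: a linear combination of its atoms. *)
Lemma mevalE env e :
  meval env e = \sum_(i < size env) mcoef e i *: nth 0 env i.
Proof.
elim: e => [n||a IHa b IHb|a IH|r a IH] /=.
- have [nlt|nge] := ltnP n (size env).
    rewrite (bigD1 (Ordinal nlt))//= eqxx scale1r big1 ?addr0// => i ni.
    rewrite ifF ?scale0r//; apply/negbTE; apply: contra ni.
    by move=> /eqP ni; apply/eqP/val_inj.
  rewrite nth_default// big1// => i _; rewrite ifF ?scale0r//.
  by apply/negbTE; rewrite gtn_eqF// (leq_trans (ltn_ord i)).
- by rewrite big1// => i _; rewrite scale0r.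
- by rewrite IHa IHb -big_split/=; apply: eq_bigr => i _; rewrite scalerDl.
- by rewrite IH -sumrN; apply: eq_bigr => i _; rewrite scaleNr.
- by rewrite IH scaler_sumr; apply: eq_bigr => i _; rewrite scalerA.
Qed.

Lemma same_coefs_meval env e1 e2 :
  same_coefs e1 e2 0 (size env) -> meval env e1 = meval env e2.
Proof.
move=> e12; rewrite !mevalE; apply: eq_bigr => i _; congr (_ *: _).
have H : forall k j, same_coefs e1 e2 j k ->
    forall i, (i < k)%N -> mcoef e1 (i + j)%N = mcoef e2 (i + j)%N.
  elim=> [//|k IH] j /= [ej ek] [_|n nk]; first by [].
  by rewrite addSnnS; exact: IH.
by have := H _ _ e12 i (ltn_ord i); rewrite addn0.
Qed.

End ModuleExpressions.

(** [lmod R] proves an identity between expressions of an R-module by comparing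
    the coefficients of each atom, which leaves ring identities in R. *)
Ltac lmod_index x env :=
  match env with
  | x :: _ => constr:(0%N)
  (* convertible atoms are identified *)
  | ?y :: _ => let _ := constr:(erefl : x = y) in constr:(0%N)
  | _ :: ?env' => let n := lmod_index x env' in constr:(S n)
  end.
Ltac lmod_atoms t env :=
  match t with
  | ?a + ?b => let env' := lmod_atoms a env in lmod_atoms b env'
  | - ?a => lmod_atoms a env
  | ?r *: ?a => lmod_atoms a env
  | 0 => env
  | _ => match env with
         | _ => let n := lmod_index t env in env
         | _ => constr:(t :: env)
         end
  end.
Ltac lmod_reify R t env :=
  match t with
  | ?a + ?b => let a' := lmod_reify R a env in
               let b' := lmod_reify R b env in constr:(MAdd a' b')
  | - ?a => let a' := lmod_reify R a env in constr:(MOpp a')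
  | ?r *: ?a => let a' := lmod_reify R a env in constr:(MScale (r : R) a')
  | 0 => constr:(MZero R)
  | _ => let n := lmod_index t env in constr:(MVar R n)
  end.
Ltac lmod R :=
  match goal with |- @eq ?V ?a ?b =>
    let env := lmod_atoms a (@nil V) in
    let env := lmod_atoms b env in
    let e1 := lmod_reify R a env in
    let e2 := lmod_reify R b env in
    apply: (@same_coefs_meval R _ env e1 e2); rewrite /=; repeat split; ring
  end.

(** * Strict differentials and first-order expansions *)
Section StrictDifferentials.
Context {R : realType}.
Implicit Types V W : normedModType R.

(** Strict differentiability: the quotients at pairs of points near [x] are
    controlled uniformly.  Unlike mere differentiability at [x], this is enough
    for solving equations near [x]; see [strict_lift]. *)
Definition strict_diff V W (f : V -> W) (x : V) (L : V -> W) : Prop :=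
  forall e : R, 0 < e -> exists2 d : R, 0 < d & forall y z,
    `|y - x| < d -> `|z - x| < d -> `|f z - f y - L (z - y)| <= e * `|z - y|.

Lemma strict_diff_precomp V V' W (P : V -> V') (f : V' -> W) x L :
  (forall y z, P z - P y = P (z - y)) -> (forall v, `|P v| <= `|v|) ->
  strict_diff f (P x) L -> strict_diff (f \o P) x (L \o P).
Proof.
move=> PB Pn fL e e0; have [d d0 H] := fL e e0; exists d => // y z yd zd /=.
rewrite -PB; apply: le_trans (H _ _ _ _) _.
- by rewrite PB (le_lt_trans (Pn _)).
- by rewrite PB (le_lt_trans (Pn _)).
- by rewrite PB ler_wpM2l// ltW.
Qed.

Lemma strict_diffB V W (f1 f2 : V -> W) x L1 L2 :
  strict_diff f1 x L1 -> strict_diff f2 x L2 ->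
  strict_diff (fun v => f1 v - f2 v) x (fun v => L1 v - L2 v).
Proof.
move=> H1 H2 e e0; have e20 : 0 < e / 2 by rewrite divr_gt0.
have [d1 d10 {}H1] := H1 _ e20; have [d2 d20 {}H2] := H2 _ e20.
exists (Num.min d1 d2) => [|y z]; first by rewrite lt_min d10.
rewrite !lt_min => /andP[y1 y2] /andP[z1 z2].
have -> : f1 z - f2 z - (f1 y - f2 y) - (L1 (z - y) - L2 (z - y)) =
    (f1 z - f1 y - L1 (z - y)) - (f2 z - f2 y - L2 (z - y)) by lmod R.
rewrite (le_trans (ler_normB _ _))//.
by have := lerD (H1 _ _ y1 z1) (H2 _ _ y2 z2); lra.
Qed.

Definition fderiv V W (f : V -> W) (x : V) (L : V -> W) : Prop :=
  forall e : R, 0 < e -> exists2 d : R, 0 < d & forall z,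
    `|z - x| < d -> `|f z - f x - L (z - x)| <= e * `|z - x|.

Lemma strict_diff_fderiv V W (f : V -> W) x L :
  strict_diff f x L -> fderiv f x L.
Proof.
move=> fL e /fL[d d0 H]; exists d => // z zd.
by apply: H => //; rewrite subrr normr0.
Qed.

Lemma differentiable_fderiv V W (f : V -> W) x :
  differentiable f x -> fderiv f x ('d f x).
Proof.
move=> /diff_locally /eqaddoP fx e /fx /nbhs_normP[d d0 H].
exists d => // z zd; have := H (z - x).
by rewrite /= !fctE/= sub0r normrN subrK opprD addrA; exact.
Qed.

Lemma linear_fderiv V W (K : {linear V -> W}) x : fderiv K x K.
Proof.
move=> e e0; exists 1 => // z _.
by rewrite linearB subrr normr0 mulr_ge0// ltW.
Qed.

(** A curve is known through its expansion at a single time, since the lifted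
    curves below need not be differentiable, or even continuous, at other
    times. *)
Definition expands V (c : R -> V) (t : R) (v : V) : Prop :=
  forall e : R, 0 < e ->
    \forall u \near t, `|c u - c t - (u - t) *: v| <= e * `|u - t|.

Lemma near_norm V (x : V) (P : set V) : (\forall y \near x, P y) ->
  exists2 d : R, 0 < d & forall y, `|y - x| < d -> P y.
Proof.
move=> /nbhs_normP[d d0 H]; exists d => // y yd; apply: H.
by rewrite /= distrC.
Qed.

Lemma near_dist (t d : R) : 0 < d -> \forall u \near t, `|u - t| < d.
Proof.
move=> d0; near=> u; rewrite distrC; near: u.
exact: (@cvgr_dist_lt _ _ _ _ _ id).
Unshelve. all: by end_near. Qed.

Lemma near_dist_mul (t : R) (C d : R) : 0 <= C -> 0 < d ->
  \forall u \near t, C * `|u - t| < d.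
Proof.
move=> C0 d0; near=> u.
have : `|u - t| < d / (C + 1).
  by near: u; apply: near_dist; rewrite divr_gt0// ltr_wpDl.
rewrite ltr_pdivlMr ?ltr_wpDl//; apply: le_lt_trans.
by rewrite mulrC ler_wpM2l// lerDl.
Unshelve. all: by end_near. Qed.

Lemma expands_lipschitz V (c : R -> V) t v : expands c t v ->
  \forall u \near t, `|c u - c t| <= (`|v| + 1) * `|u - t|.
Proof.
move=> cv; have := cv 1 ltr01; apply: filterS => u cu.
have -> : c u - c t = (c u - c t - (u - t) *: v) + (u - t) *: v by rewrite subrK.
by rewrite (le_trans (ler_normD _ _))// normrZ; lra.
Qed.

Lemma expands_near V (c : R -> V) t v d : expands c t v -> 0 < d ->
  \forall u \near t, `|c u - c t| < d.
Proof.
move=> cv d0; near=> u.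
have cu : `|c u - c t| <= (`|v| + 1) * `|u - t|.
  by near: u; exact: expands_lipschitz cv.
apply: le_lt_trans cu _; near: u; apply: near_dist_mul => //.
Unshelve. all: by end_near. Qed.

Lemma expands_continuous V (c : R -> V) t v :
  expands c t v -> {for t, continuous c}.
Proof.
move=> cv; apply/cvgrPdist_lt => d d0; near=> u; rewrite distrC.
by near: u; exact: expands_near cv d0.
Unshelve. all: by end_near. Qed.

Lemma expands_line V (x : V) (t : R) v : expands (fun u => x + (u - t) *: v) t v.
Proof.
move=> e e0; near=> u.
rewrite subrr scale0r addr0 [x + _]addrC addrK subrr normr0.
by rewrite mulr_ge0// ltW.
Unshelve. all: by end_near. Qed.

Lemma expands_uniq V (c : R -> V) t v w :
  expands c t v -> expands c t w -> v = w.
Proof.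
move=> cv cw; apply/eqP; rewrite -subr_eq0 -normr_le0; apply/ler_addgt0Pl => e e0.
rewrite addr0; have e20 : 0 < e / 2 by rewrite divr_gt0.
have [d d0 H] : exists2 d : R, 0 < d & forall u, `|u - t| < d ->
   `|c u - c t - (u - t) *: v| <= e / 2 * `|u - t| /\
   `|c u - c t - (u - t) *: w| <= e / 2 * `|u - t|.
  exact: near_norm (filterI (cv _ e20) (cw _ e20)).
have d20 : 0 < d / 2 by rewrite divr_gt0.
have := H (t + d / 2); rewrite addrAC subrr add0r gtr0_norm//.
have -> : d / 2 < d by rewrite ltr_pdivrMr// ltr_pMr// ltr1n.
move=> /(_ isT)[h1 h2].
have : `|(d / 2) *: (v - w)| <= e * (d / 2).
  have -> : (d / 2) *: (v - w) =
    (c (t + d / 2) - c t - (d / 2) *: w) - (c (t + d / 2) - c t - (d / 2) *: v).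
    by lmod R.
  by rewrite (le_trans (ler_normB _ _))//; lra.
by rewrite normrZ gtr0_norm// mulrC ler_pM2r.
Qed.

Lemma expands_comp V W (f : V -> W) (c : R -> V) t v (L : {linear V -> W}) :
  continuous L -> fderiv f (c t) L -> expands c t v ->
  expands (f \o c) t (L v).
Proof.
move=> Lc fL cv e e0.
have [k k0 Lk] := linear_lipschitz Lc.
have C0 : 0 < `|v| + 1 by rewrite ltr_wpDl.
have [|d d0 fd] := fL (e / 2 / (`|v| + 1)); first by rewrite !divr_gt0.
near=> u.
have cu1 : `|c u - c t| < d by near: u; exact: expands_near cv d0.
have cu2 : `|c u - c t| <= (`|v| + 1) * `|u - t|.
  by near: u; exact: expands_lipschitz cv.
have cu3 : `|c u - c t - (u - t) *: v| <= (e / 2 / k) * `|u - t|.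
  by near: u; apply: cv; rewrite !divr_gt0.
have /= fu := fd _ cu1.
have -> : f (c u) - f (c t) - (u - t) *: L v =
  (f (c u) - f (c t) - L (c u - c t)) + L (c u - c t - (u - t) *: v).
  rewrite [L (_ - (u - t) *: v)]linearB [L (_ *: _)]linearZZ.
  lmod R.
rewrite (le_trans (ler_normD _ _))//.
have h1 : `|L (c u - c t - (u - t) *: v)| <= e / 2 * `|u - t|.
  rewrite (le_trans (Lk _))// (le_trans (ler_wpM2l (ltW k0) cu3))//.
  have -> : k * (e / 2 / k * `|u - t|) = e / 2 * `|u - t|.
    by field; rewrite gt_eqF.
  by [].
have h2 : e / 2 / (`|v| + 1) * `|c u - c t| <= e / 2 * `|u - t|.
  by rewrite -mulrA ler_pM2l ?divr_gt0// mulrC ler_pdivrMr// mulrC.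
by lra.
Unshelve. all: by end_near. Qed.

Lemma differentiable_expands (V : normedModType R) (f : R -> V) t :
  differentiable f t -> expands f t ('D_1 f t).
Proof.
move=> df r r0; have [d d0 H] := differentiable_fderiv df r0.
near=> u; have := H u; rewrite deriveE//.
have -> : 'd f t (u - t) = (u - t) *: 'd f t 1.
  by rewrite -linearZZ /GRing.scale/= mulr1.
apply; near: u; exact: near_dist.
Unshelve. all: by end_near. Qed.

Lemma expands_near_eq (V : normedModType R) (f h : R -> V) t v :
  (\forall u \near t, f u = h u) -> expands f t v -> expands h t v.
Proof.
move=> fh fv e e0; have ft := nbhs_singleton fh.
by apply: filterS2 fh (fv e e0) => u <-; rewrite -ft.
Qed.

End StrictDifferentials.

(** * Estimates in coordinates and lifting of curves *)
Section RowVectors.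
Context {R : realType}.
Implicit Types V W : normedModType R.

Lemma coord_le_norm n (v : 'rV[R]_n) j : `|v 0 j| <= `|v|.
Proof.
by rewrite [leRHS]/Num.Def.normr /= mx_normrE; apply/bigmax_geP; right => /=; exists (0, j).
Qed.

Lemma norm_le_coord n (v : 'rV[R]_n) e :
  0 <= e -> (forall j, `|v 0 j| <= e) -> `|v| <= e.
Proof.
move=> e0 ve; rewrite [leLHS]/Num.Def.normr /= mx_normrE; apply/bigmax_leP; split => //=.
by case=> i j _ /=; rewrite ord1.
Qed.

Lemma linear_rV_coord n W (L : {linear 'rV[R]_n -> W}) v :
  L v = \sum_j v 0 j *: L (delta_mx 0 j).
Proof.
rewrite {1}(row_sum_delta v) linear_sum.
by apply: eq_bigr => j _; rewrite linearZ.
Qed.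

Lemma comb_bound n W (b : 'I_n -> W) (v : 'rV[R]_n) :
  `|\sum_j v 0 j *: b j| <= (\sum_j `|b j|) * `|v|.
Proof.
rewrite (le_trans (ler_norm_sum _ _ _))// mulr_suml ler_sum// => j _.
by rewrite normrZ mulrC ler_wpM2l// coord_le_norm.
Qed.

Lemma rV_linear_continuous n W (K : {linear 'rV[R]_n -> W}) : continuous K.
Proof.
apply: bounded_linear_continuous; apply/linear_boundedP; near=> r => v.
rewrite linear_rV_coord (le_trans (comb_bound _ _))// ler_wpM2r//.
Unshelve. all: by end_near. Qed.

Lemma linear_sub_bound n W (L L' : {linear 'rV[R]_n -> W}) e v :
  (forall j, `|L (delta_mx 0 j) - L' (delta_mx 0 j)| <= e) ->
  `|L v - L' v| <= n%:R * e * `|v|.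
Proof.
move=> Le; rewrite linear_rV_coord (linear_rV_coord L') -sumrB.
under eq_bigr do rewrite -scalerBr.
rewrite (le_trans (comb_bound _ _))// ler_wpM2r//.
apply: (@le_trans _ _ (\sum_(j < n) e)); first exact: ler_sum.
by rewrite sumr_const card_ord mulr_natl.
Qed.

Lemma norm_row_mx n1 n2 (u : 'rV[R]_n1) (v : 'rV[R]_n2) :
  `|row_mx u v| <= `|u| + `|v|.
Proof.
apply: norm_le_coord => [|j]; first by rewrite addr_ge0.
rewrite mxE; case: splitP => k _.
  by rewrite (le_trans (coord_le_norm _ _))// lerDl.
by rewrite (le_trans (coord_le_norm _ _))// lerDr.
Qed.

Lemma strict_diff_row_mx V m n (f1 : V -> 'rV[R]_m) (f2 : V -> 'rV[R]_n) x L1 L2 :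
  strict_diff f1 x L1 -> strict_diff f2 x L2 ->
  strict_diff (fun v => row_mx (f1 v) (f2 v)) x (fun v => row_mx (L1 v) (L2 v)).
Proof.
move=> H1 H2 e e0; have e20 : 0 < e / 2 by rewrite divr_gt0.
have [d1 d10 {}H1] := H1 _ e20; have [d2 d20 {}H2] := H2 _ e20.
exists (Num.min d1 d2) => [|y z]; first by rewrite lt_min d10.
rewrite !lt_min => /andP[y1 y2] /andP[z1 z2].
rewrite !opp_row_mx !add_row_mx (le_trans (norm_row_mx _ _))//.
by have := lerD (H1 _ _ y1 z1) (H2 _ _ y2 z2); lra.
Qed.

Lemma segment_in_ball V (p q x : V) (d s : R) : 0 <= s -> s <= 1 ->
  `|p - x| < d -> `|q - x| < d -> `|p + s *: (q - p) - x| < d.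
Proof.
move=> s0 s1 pd qd.
have -> : p + s *: (q - p) - x = (1 - s) *: (p - x) + s *: (q - x) by lmod R.
rewrite (le_lt_trans (ler_normD _ _))// !normrZ ger0_norm ?subr_ge0//.
by rewrite (ger0_norm s0); have [slt|] := ltP s 1; nra.
Qed.

Lemma is_diff_line V (x v : V) (t : R) :
  is_diff t (fun s : R => x + s *: v) ( *:%R^~ v).
Proof.
by have := is_diffD (is_diff_cst x t) (is_diff_scalel t v); rewrite add0r; exact.
Qed.

Lemma MVT01 (g dg : R -> R) :
  (forall t : R, t \in `[0, 1] -> is_derive t 1 g (dg t)) ->
  exists2 c : R, c \in `[0, 1] & g 1 - g 0 = dg c.
Proof.
move=> gdg; have gdg' (t : R) : t \in `]0, 1[ -> is_derive t 1 g (dg t).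
  by move=> /subset_itv_oo_cc; exact: gdg.
have [|c c01] := MVT_segment ler01 gdg'; last by rewrite subr0 mulr1; exists c.
by apply: derivable_within_continuous => t /gdg[].
Qed.

(** The mean value theorem on the segment between two points near [x], applied
    to each coordinate of [f] since it fails for vector values. *)
Lemma C1_strict_diff m n (U : set 'rV[R]_m) (f : 'rV[R]_m -> 'rV[R]_n) x :
  open U -> U x -> Ck 1 U f -> strict_diff f x ('d f x).
Proof.
move=> oU Ux [df Df] e e0.
(* a linear map is controlled by its [m] values on the basis, so that the
   tolerance is shared among them; the 1 is there for [m = 0] *)
pose e1 := e / (m%:R + 1).
have e10 : 0 < e1 by rewrite divr_gt0// ltr_wpDl.
have [d d0 Hd] : exists2 d : R, 0 < d & forall y, `|y - x| < d ->
    U y /\ forall i : 'I_m,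
      `|'D_(delta_mx 0 i) f x - 'D_(delta_mx 0 i) f y| <= e1.
  apply: near_norm; near=> y; split.
    by near: y; exact: open_nbhs_nbhs.
  move=> i; move: i; near: y; apply: filter_forall => i.
  have /= := Df (delta_mx 0 i) x; rewrite inE => /(_ Ux).
  move=> /cvgr_dist_le => /(_ _ e10) H; exact: H.
exists d => // y z yd zd.
pose p (t : R) := y + t *: (z - y).
have pd (t : R) : t \in `[0, 1] -> `|p t - x| < d.
  rewrite in_itv/= => /andP[t0 t1].
  exact: segment_in_ball.
have dp (t : R) : t \in `[0, 1] -> is_derive t 1 (f \o p) ('d f (p t) (z - y)).
  move=> t01; have [Up _] := Hd _ (pd _ t01).
  have dfp : differentiable f (p t) := df _ Up.
  have dpt : is_diff t p ( *:%R^~ (z - y)) := is_diff_line y (z - y) t.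
  have dc : differentiable (f \o p) t by apply: differentiable_comp.
  apply: DeriveDef; first exact: diff_derivable.
  rewrite deriveE//.
  rewrite diff_comp//.
  by rewrite /= (@diff_val _ _ _ _ _ _ _ dpt) scale1r.
have key (t : R) : t \in `[0, 1] -> `|'d f (p t) (z - y) - 'd f x (z - y)| <= e * `|z - y|.
  move=> t01; have [Up Hp] := Hd _ (pd _ t01).
  apply: (@le_trans _ _ (m%:R * e1 * `|z - y|)).
    apply: linear_sub_bound => j; have := Hp j.
    by rewrite distrC !deriveE//; exact: df.
  rewrite ler_wpM2r// /e1 mulrCA ger_pMr//.
  by rewrite ler_pdivrMr ?ltr_wpDl// mul1r lerDl.
apply: norm_le_coord => [|j]; first by rewrite mulr_ge0// ltW.
pose g (t : R) : R := f (p t) 0 j.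
have [dg dgE] : exists dg : R -> R, forall t, dg t = 'd f (p t) (z - y) 0 j.
  by eexists.
have gdg (t : R) : t \in `[0, 1] -> is_derive t 1 g (dg t).
  move=> t01; have [dfp dfpE] := dp _ t01; rewrite dgE -dfpE.
  have /derivable_mxP/(_ 0 j) dfpj := dfp.
  apply: DeriveDef => //.
  by rewrite derive_mx// mxE.
have [c c01] := MVT01 gdg.
rewrite dgE => gc.
have p1 : p 1 = z by rewrite /p; lmod R.
have p0 : p 0 = y by rewrite /p; lmod R.
rewrite /g p1 p0 in gc.
have -> : (f z - f y - 'd f x (z - y)) 0 j =
    ('d f (p c) (z - y) - 'd f x (z - y)) 0 j by rewrite !mxE gc.
exact: le_trans (coord_le_norm _ _) (key _ c01).
Unshelve. all: by end_near. Qed.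

Lemma half_contraction_fixpoint m (T : 'rV[R]_m -> 'rV[R]_m) r : 0 <= r ->
  (forall w, `|w| <= r -> `|T w| <= r) ->
  (forall w w', `|w| <= r -> `|w'| <= r -> `|T w - T w'| <= 2^-1 * `|w - w'|) ->
  exists2 w, `|w| <= r & T w = w.
Proof.
move=> r0 Tr Tlip; pose U := [set w : 'rV[R]_m | `|w| <= r].
have TU : set_fun U U T by [].
pose TT : {fun U >-> U} := mkfun_fun TU.
pose X : completeNormedModType R :=
  HB.pack_for (completeNormedModType R) 'rV[R]_m.
have [|||w Uw wT] := @banach_fixed_point R X U TT.
- exists (2^-1)%:nng; split => /=; first by rewrite invf_lt1// ltr1n.
  by move=> [w w'] [/= Uw Uw']; exact: Tlip.
- have -> : U = (fun w : 'rV[R]_m => `|w|) @^-1` [set x | x <= r] by [].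
  apply: closed_comp; last exact: closed_le.
  by move=> w _; exact: norm_continuous.
- by exists 0; rewrite /U/= normr0.
by exists w.
Qed.

(** Lifting through a submersion to first order.  Let [B] be a right inverse of
    the surjection [L].  The point sought is [x + (u - t) b + B w] where [w] is
    a fixed point of the simplified Newton iteration
    [w |-> w - (F (x + (u - t) b + B w) - c u)].  Strict differentiability makes
    this map contract by 1/2, and its value at 0 comes from the errors in the
    expansions of [c] and of [F], which are small compared with [u - t]. *)
Lemma strict_lift V m (F : V -> 'rV[R]_m) (x : V)
    (L : {linear V -> 'rV[R]_m}) (c : R -> 'rV[R]_m) (t : R) (b : V) :
  strict_diff F x L -> (forall w, exists v, L v = w) ->
  c t = F x -> expands c t (L b) ->
  forall e, 0 < e -> \forall u \near t, exists2 p, F p = c u &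
    `|p - x - (u - t) *: b| <= e * `|u - t|.
Proof.
move=> FL Lsurj ct cb e e0.
have /choice[bb Lbb] : forall j : 'I_m, exists v, L v = delta_mx 0 j.
  by move=> j; exact: Lsurj.
pose B (w : 'rV[R]_m) := \sum_j w 0 j *: bb j.
have LB w : L (B w) = w.
  rewrite linear_sum [RHS]row_sum_delta; apply: eq_bigr => j _.
  by rewrite linearZ/= Lbb.
have BB w w' : B w - B w' = B (w - w').
  rewrite /B -sumrB; apply: eq_bigr => j _.
  by rewrite !mxE scalerBl.
pose C := \sum_j `|bb j| + 1.
have C0 : 0 < C by rewrite ltr_wpDl// sumr_ge0.
have BC w : `|B w| <= C * `|w|.
  by rewrite (le_trans (comb_bound _ _))// ler_wpM2r// lerDl.
have b10 : 0 < `|b| + 1 by rewrite ltr_wpDl.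
(* [C] bounds [B], so that the first tolerance gives the Lipschitz constant 1/2;
   the second one bounds by [rho / 4] the contribution of [F] to the value at 0
   of the iteration on the ball of radius [rho] *)
have [|d d0 Fd] := FL ((2 * C)^-1).
  by rewrite invr_gt0 mulr_gt0.
have [|d1 d10 Fd1] := FL (e / (4 * C) / (`|b| + 1)).
  by rewrite !divr_gt0// mulr_gt0.
near=> u.
have ud : (`|b| + e) * `|u - t| < d.
  by near: u; apply: near_dist_mul => //; rewrite addr_ge0// ltW.
have ud1 : `|b| * `|u - t| < d1 by near: u; exact: near_dist_mul.
have cu : `|c u - c t - (u - t) *: L b| <= e / (4 * C) * `|u - t|.
  by near: u; apply: cb; rewrite divr_gt0// mulr_gt0.
set s := u - t in ud ud1 cu *.
pose p0 := x + s *: b.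
pose rho := e / C * `|s|.
have rho0 : 0 <= rho by rewrite mulr_ge0// divr_ge0 ?ltW.
have p0d w : `|w| <= rho -> `|p0 + B w - x| < d.
  move=> wr; rewrite /p0 addrAC [x + _]addrC addrK.
  rewrite (le_lt_trans (ler_normD _ _))// normrZ.
  apply: le_lt_trans ud; rewrite mulrDl mulrC lerD2l.
  rewrite (le_trans (BC _))// (le_trans (ler_wpM2l (ltW C0) wr))//.
  by rewrite /rho mulrA mulrCA divff ?mulr1// gt_eqF.
pose T w := w - (F (p0 + B w) - c u).
have Tlip w w' : `|w| <= rho -> `|w'| <= rho -> `|T w - T w'| <= 2^-1 * `|w - w'|.
  move=> wr wr'; have := Fd _ _ (p0d _ wr') (p0d _ wr).
  have -> : p0 + B w - (p0 + B w') = B (w - w').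
    by rewrite -BB opprD addrACA subrr add0r.
  rewrite LB -normrN => H.
  have -> : T w - T w' = - (F (p0 + B w) - F (p0 + B w') - (w - w')).
    by rewrite /T; lmod R.
  apply: le_trans H _.
  apply: (le_trans (ler_wpM2l _ (BC _))).
    by rewrite invr_ge0 ltW// mulr_gt0.
  by rewrite invfM mulrA divfK// gt_eqF.
have T0 : `|T 0| <= rho / 2.
  have B0 : B 0 = 0 by rewrite /B big1// => j _; rewrite mxE scale0r.
  rewrite /T B0 addr0 sub0r opprB.
  have -> : c u - F p0 = (c u - c t - s *: L b) - (F p0 - F x - L (p0 - x)).
    have -> : p0 - x = s *: b by rewrite /p0 addrC addKr.
    by rewrite [L (_ *: _)]linearZZ ct; lmod R.
  rewrite (le_trans (ler_normB _ _))//.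
  have px : p0 - x = s *: b by rewrite /p0 addrC addKr.
  have h : `|F p0 - F x - L (p0 - x)| <= e / (4 * C) * `|s|.
    apply: le_trans (Fd1 _ _ _ _) _; first by rewrite subrr normr0.
      by rewrite px normrZ mulrC.
    rewrite -[leLHS]mulrA; apply: ler_wpM2l.
      by rewrite ltW// divr_gt0// mulr_gt0.
    rewrite px normrZ.
    by rewrite ler_pdivrMl// mulrC ler_wpM2r// lerDl.
  rewrite (le_trans (lerD cu h))// /rho.
  have -> : e / (4 * C) * `|s| + e / (4 * C) * `|s| = e / C * `|s| / 2.
    by field; rewrite gt_eqF.
  by [].
have [w Uw wT] : exists2 w, `|w| <= rho & T w = w.
  apply: half_contraction_fixpoint => // w Uw.
  have -> : T w = (T w - T 0) + T 0 by rewrite subrK.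
  rewrite (le_trans (ler_normD _ _))//.
  have := Tlip w 0 Uw; rewrite normr0 subr0 => /(_ rho0).
  by move: Uw; lra.
exists (p0 + B w).
  move: wT => /eqP; rewrite -subr_eq0 /T addrAC subrr sub0r oppr_eq0.
  by rewrite subr_eq0 => /eqP.
have -> : p0 + B w - x - s *: b = B w by rewrite /p0; lmod R.
rewrite (le_trans (BC _))// (le_trans (ler_wpM2l (ltW C0) Uw))//.
by rewrite /rho mulrA mulrCA divff ?mulr1// gt_eqF.
Unshelve. all: by end_near. Qed.

End RowVectors.

(** * Functions of class Ck *)
Section CkClasses.
Context {R : realType}.
Implicit Types V W : normedModType R.

Lemma continuous_at_ext (X Y : topologicalType) (U : set X) (f g : X -> Y) x :
  open U -> {in U, f =1 g} -> U x -> {for x, continuous f} ->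
  {for x, continuous g}.
Proof.
move=> oU fg Ux cf; rewrite /prop_for /continuous_at -fg ?inE//.
apply: cvg_trans cf; apply: near_eq_cvg.
have : nbhs x U by exact: open_nbhs_nbhs.
by apply: filterS => y Uy; rewrite fg// inE.
Qed.

Lemma differentiable_ext V W (U : set V) (f g : V -> W) x :
  open U -> {in U, f =1 g} -> U x -> differentiable f x ->
  differentiable g x /\ 'd g x = 'd f x :> (V -> W).
Proof.
move=> oU fg Ux dfx.
have cdf := diff_continuous dfx.
have E : g \o shift x = cst (g x) + 'd f x +o_ 0 id.
  apply/eqaddoP => e e0.
  have := diff_locally dfx => /eqaddoP /(_ _ e0).
  apply: filter_app.
  have [d d0 H] : exists2 d : R, 0 < d & forall y, `|y - x| < d -> U y.
    by apply: near_norm; exact: open_nbhs_nbhs.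
  apply/nbhs_normP; exists d => // h /=; rewrite sub0r normrN => hd.
  by rewrite !fctE/= !fg ?inE//; apply: H; rewrite addrK.
have dE := diff_unique cdf E.
by split => //; apply/diff_locallyP; rewrite dE.
Qed.

Lemma Ck_ext V W (U : set V) (f g : V -> W) k :
  open U -> {in U, f =1 g} -> Ck k U f -> Ck k U g.
Proof.
move=> oU; elim: k f g => [|k IH] f g fg /=.
  move=> cf x Ux; apply: (continuous_at_ext oU fg); first by rewrite inE in Ux.
  exact: cf.
move=> [df Df]; split => [x Ux|v].
  by have [] := differentiable_ext oU fg Ux (df x Ux).
apply: IH (Df v) => x; rewrite inE => Ux; apply: near_eq_derive.
have : nbhs x U by exact: open_nbhs_nbhs.
by apply: filterS => y Uy; rewrite fg// inE.
Qed.

Lemma CkD V W (U : set V) (f g : V -> W) k :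
  open U -> Ck k U f -> Ck k U g -> Ck k U (fun x => f x + g x).
Proof.
move=> oU; elim: k f g => [|k IH] f g /=.
  by move=> cf cg x Ux; apply: cvgD; [exact: cf|exact: cg].
move=> [df Df] [dg Dg]; split => [x Ux|v].
  by apply: differentiableD; [exact: df|exact: dg].
apply: Ck_ext (IH _ _ (Df v) (Dg v)) => // x; rewrite inE => Ux.
have dfx := df x Ux; have dgx := dg x Ux.
by rewrite deriveD//; exact: diff_derivable.
Qed.

Lemma smooth_on_derive V W (U : set V) (f : V -> W) v :
  smooth_on U f -> smooth_on U ('D_v f).
Proof. by move=> sf k; have [_] := sf k.+1; exact. Qed.

Lemma diff_not_differentiable (V W : normedModType R) (f : V -> W) x v :
  ~ differentiable f x -> 'd f x v = 0.
Proof.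
move=> nd; rewrite /diff.
set P := fun df : {linear V -> W} => _.
have [[df Pdf]|nP] := pselect (exists df, P df).
  by exfalso; apply: nd; apply/diffP; exact: (@getPex _ P (ex_intro _ df Pdf)).
by have -> : get P = point by apply: getPN => df Pdf; apply: nP; exists df.
Qed.

End CkClasses.

(** * A smooth reparametrization of segments *)
Section TrigonometricSegments.
Context {R : realType}.
Implicit Types W : normedModType R.

(** An algebra of functions that is closed under derivation, hence consists of
    smooth functions. *)
Inductive trig : (R -> R) -> Prop :=
| trig_cst a : trig (cst a)
| trig_sin : trig (fun t => sin (pi * t))
| trig_cos : trig (fun t => cos (pi * t))
| trigD f g : trig f -> trig g -> trig (fun t => f t + g t)
| trigM f g : trig f -> trig g -> trig (fun t => f t * g t).

Lemma is_derive_pi_mul (t : R) : is_derive t 1 (fun s : R => pi * s) (pi : R).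
Proof.
have := is_deriveM (is_derive_cst (pi : R) t 1) (is_derive_id t 1).
by rewrite scaler0 addr0 => H; apply: is_derive_eq H _; rewrite /cst/= scaler1.
Qed.

Lemma trig_derive f : trig f ->
  exists2 g, trig g & forall t : R, is_derive t 1 f (g t).
Proof.
elim => {f} [a|||f g _ [f' tf' df] _ [g' tg' dg]|f g tf [f' tf' df] tg [g' tg' dg]].
- by exists (cst 0); [exact: trig_cst|move=> t; exact: is_derive_cst].
- exists (fun t => cst pi t * cos (pi * t)).
    by apply: trigM; [exact: trig_cst|exact: trig_cos].
  move=> t.
  have H := is_derive1_comp (is_derive_sin (pi * t)) (is_derive_pi_mul t).
  apply: is_derive_eq H _.
  by rewrite /cst mulrC.
- exists (fun t => cst (- pi) t * sin (pi * t)).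
    by apply: trigM; [exact: trig_cst|exact: trig_sin].
  move=> t.
  have H := is_derive1_comp (is_derive_cos (pi * t)) (is_derive_pi_mul t).
  apply: is_derive_eq H _.
  by rewrite /cst mulNr [RHS]mulNr (mulrC pi (sin _)).
- exists (fun t => f' t + g' t); first exact: trigD.
  by move=> t; exact: is_deriveD.
- exists (fun t => f t * g' t + g t * f' t); first by apply: trigD; exact: trigM.
  by move=> t; exact: is_deriveM.
Qed.

Lemma trig_continuous f : trig f -> continuous f.
Proof.
move=> tf t; have [f' _ df] := trig_derive tf.
have dft : differentiable f t by apply/derivable1_diffP; have [] := df t.
exact: differentiable_continuous dft.
Qed.

(** Smooth curves are defined for all real times, so a segment is run through
    with a parameter that never leaves [0, 1] and goes from 0 to 1 monotonically
    on [0, 1].  The curve then stays in the chart at all times, and has the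
    length of the segment on [0, 1]. *)
Definition ramp (t : R) : R := 2^-1 * (1 - cos (pi * t)).
Definition dramp (t : R) : R := 2^-1 * (pi * sin (pi * t)).

Lemma trig_dramp : trig dramp.
Proof.
apply: (@trigM (cst 2^-1)); first exact: trig_cst.
by apply: (@trigM (cst pi)); [exact: trig_cst|exact: trig_sin].
Qed.

Lemma is_derive_ramp (t : R) : is_derive t 1 ramp (dramp t).
Proof.
have dc := is_derive1_comp (is_derive_cos (pi * t)) (is_derive_pi_mul t).
have := is_deriveM (is_derive_cst (2^-1 : R) t 1)
  (is_deriveB (is_derive_cst (1 : R) t 1) dc).
rewrite scaler0 addr0 => H; apply: is_derive_eq H _.
by rewrite /dramp sub0r mulNr opprK (mulrC pi (sin _)).
Qed.

Lemma ramp0 : ramp 0 = 0.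
Proof. by rewrite /ramp mulr0 cos0 subrr mulr0. Qed.

Lemma ramp1 : ramp 1 = 1.
Proof. by rewrite /ramp mulr1 cospi opprK; lra. Qed.

Lemma ramp_itv t : 0 <= ramp t <= 1.
Proof.
rewrite /ramp; have := cos_max (pi * t); rewrite ler_norml => /andP[c1 c2].
by apply/andP; split; lra.
Qed.

Lemma dramp_ge0 t : 0 <= t <= 1 -> 0 <= dramp t.
Proof.
move=> /andP[t0 t1]; rewrite /dramp !mulr_ge0//; first exact: pi_ge0.
apply: sin_ge0_pi; apply/andP; split; first by rewrite mulr_ge0// pi_ge0.
by rewrite ler_piMr// pi_ge0.
Qed.

Lemma is_derive_scale_mx m (a : R -> R) (f : R -> 'rV[R]_m) (t da : R) df :
  is_derive t 1 a da -> is_derive t 1 f df ->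
  is_derive t 1 (fun t => a t *: f t) (da *: f t + a t *: df).
Proof.
move=> ada [/[dup] fd /derivable_mxP fij <-].
have E i j : is_derive t 1 (fun s : R => (a s *: f s) i j)
    (a t *: 'D_1 (fun s : R => f s i j) t + f t i j *: da).
  have -> : (fun s : R => (a s *: f s) i j) = a * (fun s : R => f s i j).
    by apply/funext => s; rewrite mxE.
  by apply: is_deriveM; exact: DeriveDef.
have D : derivable (fun s => a s *: f s) t 1.
  by apply/derivable_mxP => i j; have [] := E i j.
apply: DeriveDef => //; rewrite derive_mx//; apply/matrixP => i j.
rewrite mxE; have [_ ->] := E i j.
have -> : 'D_1 (fun s : R => f s i j) t = ('D_1 f t) i j.
  by rewrite (derive_mx fd) mxE.
by move: ('D_1 f t) => D0; rewrite !mxE addrC /GRing.scale/= [f t i j * _]mulrC.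
Qed.

Lemma derive_line W (f : R -> W) (t v : R) :
  differentiable f t -> 'D_v f t = v *: 'D_1 f t.
Proof.
move=> df; rewrite !deriveE//; have {1}-> : v = v *: (1 : R^o).
  by rewrite /GRing.scale/= mulr1.
by rewrite linearZ.
Qed.

(** The factor [a] makes the induction on [k] go through: the derivative of
    [a t F(p + ramp t w)] is the sum of two functions of the same form, with [F]
    and with its derivative along [w]. *)
Lemma Ck_ramp_segment n m (U : set 'rV[R]_n) (F : 'rV[R]_n -> 'rV[R]_m) p w k :
  open U -> smooth_on U F -> forall a, trig a ->
  Ck k [set t : R^o | U (p + ramp t *: w)]
    (fun t : R^o => a t *: F (p + ramp t *: w)).
Proof.
move=> oU; pose q (t : R) := p + ramp t *: w.
have dq (t : R) : is_derive t 1 q (dramp t *: w).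
  have := is_derive_scale_mx (is_derive_ramp t) (is_derive_cst w t 1).
  rewrite scaler0 addr0 => H.
  by have := is_deriveD (is_derive_cst p t 1) H; rewrite add0r; exact.
have diffq (t : R) : differentiable q t.
  by apply/derivable1_diffP; have [] := dq t.
have oQ : open [set t : R^o | U (q t)].
  apply: open_comp oU => t _; exact: differentiable_continuous.
have dF (F' : 'rV[R]_n -> 'rV[R]_m) (a : R -> R) (t da : R) : smooth_on U F' -> U (q t) ->
    is_derive t 1 a da -> is_derive t 1 (fun t : R => a t *: F' (q t))
      (da *: F' (q t) + (a t * dramp t) *: 'D_w F' (q t)).
  move=> sF Uq ada.
  have dF' : differentiable F' (q t) by have [+ _] := sF 1%N; exact.
  have dFq : differentiable (F' \o q) t by exact: differentiable_comp.
  have Fq : is_derive t 1 (F' \o q) (dramp t *: 'D_w F' (q t)).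
    apply: DeriveDef; first exact/derivable1_diffP.
    rewrite deriveE// diff_comp//= -(deriveE _ (diffq t)).
    by have [_ ->] := dq t; rewrite linearZ/= deriveE.
  have := is_derive_scale_mx ada Fq.
  by rewrite scalerA; exact.
elim: k F => [|k IH] F sF a ta /=; have [a' ta' da] := trig_derive ta.
  move=> t; rewrite inE => Ut; apply: differentiable_continuous.
  by apply/derivable1_diffP; have [] := dF F a t _ sF Ut (da t).
split=> [t Ut|v].
  by apply/derivable1_diffP; have [] := dF F a t _ sF Ut (da t).
have tv : trig (cst v) := trig_cst v.
have C1 := IH F sF _ (trigM tv ta').
have C2 := IH _ (smooth_on_derive w sF) _ (trigM tv (trigM ta trig_dramp)).
apply: Ck_ext (CkD oQ C1 C2) => // t; rewrite inE => Ut.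
have [Fd FE] := dF F a t _ sF Ut (da t).
have Fdiff : differentiable (fun t : R => a t *: F (q t)) t.
  exact/derivable1_diffP.
rewrite (derive_line v Fdiff) FE scalerDr !scalerA.
by [].
Qed.

End TrigonometricSegments.

(** * Inner products on tangent spaces *)
Section InnerProduct.
Context {R : realType} {M : manifold R} (g : rmetric M) (x : M).
Implicit Types u v w : 'rV[R]_(mdim M).

Lemma ipDl u v w : g x (u + v) w = g x u w + g x v w.
Proof. by have := ip_linear g x 1 u v w; rewrite scale1r mul1r. Qed.

Lemma ip0l w : g x 0 w = 0.
Proof. by have := ip_linear g x (-1) 0 0 w; rewrite scaler0 addr0 mulN1r addNr. Qed.

Lemma ipZl a v w : g x (a *: v) w = a * g x v w.
Proof. by have := ip_linear g x a v 0 w; rewrite addr0 ip0l addr0. Qed.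

Lemma ipDr u v w : g x w (u + v) = g x w u + g x w v.
Proof. by rewrite ip_sym ipDl ![g x _ w]ip_sym. Qed.

Lemma ipZr a v w : g x w (a *: v) = a * g x w v.
Proof. by rewrite ip_sym ipZl ip_sym. Qed.

Lemma ip_ge0 v : 0 <= g x v v.
Proof.
by have [->|v0] := eqVneq v 0; [rewrite ip0l|exact/ltW/ip_pos].
Qed.

Lemma ip_eq0 v : g x v v = 0 -> v = 0.
Proof. by have [//|/(ip_pos g x)/gt_eqF/eqP] := eqVneq v 0. Qed.

(** Pairing with a basis of [U] is injective on [U], as the inner product is
    positive, hence maps [U] onto all tuples of values by equality of
    dimensions.  So some element of [U] has the same pairings with [U] as
    [v]. *)
Lemma orthogonal_decomposition (U : {vspace 'T M}) v :
  exists2 w, orthogonal_to g x U w &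
    v - w \in U /\ g x v v = g x w w + g x (v - w) (v - w).
Proof.
pose L (v : 'T M) : 'rV[R]_(\dim U) := \row_i g x v (tnth (vbasis U) i).
have linL : linear L.
  by move=> a u w; apply/rowP => i; rewrite !mxE ipDl ipZl.
pose LL := GRing.isLinear.Build _ _ _ _ L linL.
pose Lf : {linear 'T M -> 'rV[R]_(\dim U)} := HB.pack L LL.
have orth w : (forall i, g x w (tnth (vbasis U) i) = 0) ->
    orthogonal_to g x U w.
  move=> w0 u /coord_vbasis ->.
  elim/big_rec : _ => [|i y _ IH]; first by rewrite ip_sym ip0l.
  rewrite ipDr IH addr0 ipZr.
  by have := w0 i; rewrite (tnth_nth 0) => ->; rewrite mulr0.
have kerU : (U :&: lker (linfun Lf) = 0)%VS.
  apply/eqP; rewrite -subv0; apply/subvP => u.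
  rewrite memv_cap memv_ker lfunE memv0 => /andP[uU /eqP/rowP Lu0].
  apply/eqP/ip_eq0; apply: (orth u) => // i.
  by have := Lu0 i; rewrite /= !mxE.
have imU : (linfun Lf @: U)%VS = fullv.
  apply/eqP; rewrite -dimv_leqif_eq ?subvf// limg_dim_eq//.
  by rewrite dimvf /dim/= mul1n.
have : linfun Lf v \in (linfun Lf @: U)%VS by rewrite imU memvf.
move=> /memv_imgP[u uU]; rewrite !lfunE/= => Luv.
have vuU : orthogonal_to g x U (v - u).
  apply: orth => i; have /rowP/(_ i) := Luv; rewrite !mxE => E.
  by rewrite ipDl E -scaleN1r ipZl mulN1r subrr.
exists (v - u) => //; rewrite opprB addrC subrK; split => //.
have -> : g x v v = g x (v - u + u) (v - u + u) by rewrite subrK.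
move: (v - u) vuU => w wU.
by rewrite ipDl !ipDr (ip_sym g x u w) (wU _ uU) addr0 add0r.
Qed.

End InnerProduct.

(** * Charts and tangent maps *)
Section Charts.
Context {R : realType}.
Implicit Types (T : topologicalType) (M N P Q : manifold R).

Lemma nbhs_chart T n (c : chart R T n) x : cdom c x ->
  nbhs (c x) (c @` cdom c).
Proof. by move=> cx; apply: open_nbhs_nbhs; split; [exact: cimg_open|exists x]. Qed.

Lemma cinvK T n (c : chart R T n) y : (c @` cdom c) y -> c (cinv c y) = y.
Proof. by move=> [x cx <-]; rewrite cfunK// inE. Qed.

Lemma cdom_cinv T n (c : chart R T n) y : (c @` cdom c) y -> cdom c (cinv c y).
Proof. by move=> [x cx <-]; rewrite cfunK// inE. Qed.

Lemma near_cinv T n (c : chart R T n) x (A : set T) : cdom c x -> nbhs x A ->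
  \forall y \near c x, A (cinv c y).
Proof.
move=> cx Ax; have := @cinv_continuous _ _ _ c (c x).
rewrite inE => /(_ (ex_intro2 _ _ x cx erefl)).
by apply; rewrite cfunK// inE.
Qed.

Lemma open_chart_image T n (c : chart R T n) (A : set T) :
  open A -> open (c @` (cdom c `&` A)).
Proof.
move=> oA; rewrite openE => _ [x [cx Ax] <-].
have A' : nbhs x A by exact: open_nbhs_nbhs.
apply: filterS2 (nbhs_chart cx) (near_cinv cx A') => y cy Ay.
by exists (cinv c y); [split=> //; exact: cdom_cinv|exact: cinvK].
Qed.

Definition local_map M N (f : M -> N) (x : M) : 'T M -> 'T N :=
  mchart N (f x) \o f \o cinv (mchart M x).

Definition mdiff M N (f : M -> N) (x : M) : Prop :=
  {for x, continuous f} /\ differentiable (local_map f x) (mchart M x x).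

Lemma tangent_mapE M N (f : M -> N) x v :
  tangent_map f x v = 'd (local_map f x) (mchart M x x) v.
Proof. by rewrite lfunE. Qed.

Lemma smooth_map_local M N (f : M -> N) x : smooth_map f ->
  exists2 U, open U /\ U (mchart M x x) & smooth_on U (local_map f x).
Proof.
move=> [cf sf]; have := sf _ _ (chart_at_atlas _ x) (chart_at_atlas _ (f x)).
set U := _ @` _ => sU; exists U => //; split.
  rewrite /U -setIA; apply: open_chart_image; rewrite setTI.
  apply: open_comp; last exact: cdom_open.
  by move=> y _; apply: cf; rewrite inE.
exists x => //; split; [split|] => //; exact: chart_at_dom.
Qed.

Lemma smooth_map_mdiff M N (f : M -> N) x : smooth_map f -> mdiff f x.
Proof.
move=> sf; split; first by apply: sf.1; rewrite inE.
by have [U [oU Ux] /(_ 1%N)[+ _]] := smooth_map_local x sf; exact.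
Qed.

Lemma smooth_map_strict M N (f : M -> N) x : smooth_map f ->
  strict_diff (local_map f x) (mchart M x x)
    ('d (local_map f x) (mchart M x x)).
Proof.
move=> sf; have [U [oU Ux] sU] := smooth_map_local x sf.
exact: C1_strict_diff oU Ux (sU 1%N).
Qed.

Lemma smooth_map_strict_at (M N : manifold R) (f : M -> N) x y :
  smooth_map f -> f x = y ->
  strict_diff (mchart N y \o f \o cinv (mchart M x)) (mchart M x x)
    (tangent_map f x).
Proof.
move=> sf <-; have := smooth_map_strict x sf.
have -> // : tangent_map f x = 'd (local_map f x) (mchart M x x) :> (_ -> _).
by apply/funext => v; exact: tangent_mapE.
Qed.

(** Tangent vectors as velocities of curves.  Properties of tangent maps follow
    from the uniqueness of the velocity, which avoids changes of charts and
    allows maps that are differentiable only at one point. *)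
Definition curve_at M (c : R -> M) (t : R) (x : M) (v : 'T M) : Prop :=
  [/\ c t = x, {for t, continuous c} & expands (mchart M x \o c) t v].

Lemma curve_at_map M N (f : M -> N) (c : R -> M) t x v :
  mdiff f x -> curve_at c t x v -> curve_at (f \o c) t (f x) (tangent_map f x v).
Proof.
move=> [cf df] [ctx cc cv]; split; first by rewrite /= ctx.
  by apply: continuous_comp => //; rewrite ctx.
have fd := differentiable_fderiv df.
have cdf := diff_continuous df.
rewrite tangent_mapE => e e0.
have : expands (local_map f x \o (mchart M x \o c)) t
    ('d (local_map f x) (mchart M x x) v).
  by apply: expands_comp => //=; rewrite ctx.
move=> /(_ e e0).
have cx : \forall u \near t, cdom (mchart M x) (c u).
  apply: cc; rewrite ctx; apply: open_nbhs_nbhs.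
  by split; [exact: cdom_open|exact: chart_at_dom].
apply: filterS2 cx => u cu.
rewrite /local_map/= !cfunK ?inE//.
by rewrite ctx; exact: chart_at_dom.
Qed.

Lemma curve_at_uniq M (c : R -> M) t x v w :
  curve_at c t x v -> curve_at c t x w -> v = w.
Proof. by move=> [_ _ cv] [_ _ cw]; exact: expands_uniq cv cw. Qed.

(** This curve is meaningful near the time [t] only, as a straight line may
    leave the image of the chart. *)
Definition chart_line M (x : M) (v : 'T M) (t u : R) : M :=
  cinv (mchart M x) (mchart M x x + (u - t) *: v).

Lemma chart_line_at M (x : M) (v : 'T M) t :
  curve_at (chart_line x v t) t x v.
Proof.
have dx := chart_at_dom (mstr M) x.
have ct : chart_line x v t t = x.
  by rewrite /chart_line subrr scale0r addr0 cfunK// inE.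
have cl : {for t, continuous (fun u : R => mchart M x x + (u - t) *: v)}.
  exact: expands_continuous (expands_line _ _ _).
have near_img : \forall u \near t,
    (mchart M x @` cdom (mchart M x)) (mchart M x x + (u - t) *: v).
  apply: cl; rewrite subrr scale0r addr0; exact: nbhs_chart.
split=> //.
  move=> A; rewrite ct => Ax.
  have Ay : nbhs (mchart M x x + (t - t) *: v)
      (fun y => A (cinv (mchart M x) y)).
    by rewrite subrr scale0r addr0; exact: near_cinv.
  exact: (cl _ Ay).
move=> e e0; have := expands_line (mchart M x x) t v e0.
apply: filterS2 near_img => u ui.
by rewrite /= ct /chart_line cinvK// subrr scale0r addr0.
Qed.

Lemma tangent_map_comp M N P (f : M -> N) (h : N -> P) (k : M -> P) x v :
  mdiff f x -> mdiff h (f x) -> mdiff k x -> (forall y, h (f y) = k y) ->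
  tangent_map h (f x) (tangent_map f x v) = tangent_map k x v.
Proof.
move=> df dh dk hfk; have hfkE : h \o f = k by apply/funext.
have l := chart_line_at x v 0.
apply: (curve_at_uniq (c := k \o chart_line x v 0) (t := 0) (x := k x)).
  rewrite -hfkE -[(h \o f) \o _]/(h \o (f \o chart_line x v 0)).
  by apply: curve_at_map => //; exact: curve_at_map.
exact: curve_at_map.
Qed.

Lemma tangent_map_comm M N P Q (f : M -> N) (h : N -> Q) (f' : M -> P)
    (h' : P -> Q) x y y' v :
  f x = y -> f' x = y' ->
  mdiff f x -> mdiff h y -> mdiff f' x -> mdiff h' y' ->
  (forall z, h (f z) = h' (f' z)) ->
  tangent_map h y (tangent_map f x v) = tangent_map h' y' (tangent_map f' x v).
Proof.
move=> <- <- df dh df' dh' E; have l := chart_line_at x v 0.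
have c := curve_at_map dh (curve_at_map df l).
have c' := curve_at_map dh' (curve_at_map df' l).
have cE : h \o (f \o chart_line x v 0) = h' \o (f' \o chart_line x v 0).
  by apply/funext => u /=; rewrite E.
by rewrite -cE -E in c'; exact: curve_at_uniq c c'.
Qed.

Lemma tangent_map_cancel M N (f : M -> N) (h : N -> M) x v :
  mdiff f x -> mdiff h (f x) -> cancel f h ->
  tangent_map h (f x) (tangent_map f x v) = v.
Proof.
move=> df dh hf; have l := chart_line_at x v 0.
have := curve_at_map dh (curve_at_map df l).
have -> : h \o (f \o chart_line x v 0) = chart_line x v 0.
  by apply/funext => u; rewrite /= hf.
by rewrite hf => /curve_at_uniq; apply.
Qed.

Lemma smooth_curve_at M (e : R -> M) t : smooth_curve e ->
  curve_at e t (e t) (velocity e t).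
Proof.
move=> [ce se]; split => //; first exact: ce.
have := se _ (chart_at_atlas _ (e t)) 1%N.
move=> [/(_ t (chart_at_dom _ _)) de _].
move=> r r0; have [d d0 H] := differentiable_fderiv de r0.
near=> u; have := H u; rewrite /velocity derive1E'//.
have -> : 'd (mchart M (e t) \o e) t (u - t) =
    (u - t) *: 'd (mchart M (e t) \o e) t 1.
  by rewrite -linearZZ /GRing.scale/= mulr1.
apply; near: u; exact: near_dist.
Unshelve. all: by end_near. Qed.

Lemma near_chart_cdom (M N : manifold R) (h : M -> N) x y :
  smooth_map h -> h x = y ->
  \forall p \near mchart M x x, cdom (mchart N y) (h (cinv (mchart M x) p)).
Proof.
move=> [ch _] hxy.
apply: (near_cinv (A := fun z => cdom (mchart N y) (h z)) (chart_at_dom _ x)).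
have cy : nbhs (h x) (cdom (mchart N y)).
  apply: open_nbhs_nbhs; split; first exact: cdom_open.
  by rewrite hxy; exact: chart_at_dom.
by apply: ch cy; rewrite inE.
Qed.

Lemma chart_inj (M : manifold R) (y a b : M) :
  cdom (mchart M y) a -> cdom (mchart M y) b ->
  mchart M y a = mchart M y b -> a = b.
Proof.
move=> ya yb /(congr1 (cinv (mchart M y))).
by rewrite !cfunK ?inE.
Qed.

End Charts.

(** * Growth estimates and integrals *)
Section Growth.
Context {R : realType}.

(** A function that is subadditive along the interval and whose infinitesimal
    growth is bounded by the derivative of [F] grows at most as [F].  With a
    slack proportional to the length, the points [t] for which [E a t] has the
    expected bound form a set that contains its supremum, and this supremum
    cannot be less than [b].  Both
    directions of the local bound serve: one reaches the supremum from the left,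
    then leaves it to the right. *)
Lemma growth_le (E : R -> R -> \bar R) (F s : R -> R) (a b : R) : a <= b ->
  (forall t u v, E t v <= E t u + E u v)%E ->
  (forall t, t \in `[a, b] -> is_derive t 1 F (s t)) ->
  (forall t e, t \in `[a, b] -> 0 < e -> \forall u \near t,
    (E t u <= ((s t + e) * `|u - t|)%:E)%E /\
    (E u t <= ((s t + e) * `|u - t|)%:E)%E) ->
  (E a b <= (F b - F a)%:E)%E.
Proof.
move=> ab tri dF dE; apply/lee_addgt0Pr => e e0.
(* [k] is spent twice, on the growth of [E] and on the expansion of [F]; the
   total slack [2 k (b - a)] is at most [e], and adding 1 to the denominator
   keeps it positive when [a = b] *)
pose k := e / (2 * (b - a + 1)).
have ba0 : 0 < b - a + 1 by lra.
have k0 : 0 < k by rewrite divr_gt0// mulr_gt0.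
have loc (t : R) : t \in `[a, b] -> exists2 d : R, 0 < d & forall u,
    `|u - t| < d ->
    (t <= u -> (E t u <= (F u - F t + 2 * k * (u - t))%:E)%E) /\
    (u <= t -> (E u t <= (F t - F u + 2 * k * (t - u))%:E)%E).
  move=> tab; have [d1 d10 H1] := near_norm (dE _ _ tab k0).
  have [/derivable1_diffP dft dfE] := dF _ tab.
  have [d2 d20 H2] := differentiable_fderiv dft k0.
  exists (Num.min d1 d2) => [|u]; first by rewrite lt_min d10.
  rewrite lt_min => /andP[/H1[Etu Eut] /H2].
  have -> : 'd F t (u - t) = (u - t) * s t.
    by rewrite -dfE deriveE// -[RHS]linearZZ /GRing.scale/= mulr1.
  rewrite ler_norml => /andP[h1 h2]; split=> tu.
    apply: le_trans Etu _; rewrite lee_fin; move: h1 h2.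
    by rewrite ger0_norm ?subr_ge0//; lra.
  apply: le_trans Eut _; rewrite lee_fin; move: h1 h2.
  by rewrite ler0_norm ?subr_le0//; lra.
pose P t := (E a t <= (F t - F a + 2 * k * (t - a))%:E)%E.
pose A := [set t : R | a <= t <= b /\ P t].
have step t u : P t -> (E t u <= (F u - F t + 2 * k * (u - t))%:E)%E -> P u.
  move=> Pt Etu; apply: le_trans (tri a t u) _.
  apply: le_trans (leeD Pt Etu) _.
  by rewrite -EFinD lee_fin; lra.
have aab : a \in `[a, b] by rewrite in_itv/= lexx.
have Aa : A a.
  split; first by rewrite lexx.
  have [d d0 /(_ a)] := loc a aab.
  rewrite subrr normr0 => /(_ d0)[/(_ (lexx a)) + _].
  by rewrite /P !subrr.
have supA : has_sup A.
  by split; [exists a|exists b => t [/andP[]]].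
set c := sup A.
have cab : c \in `[a, b].
  rewrite in_itv/=; apply/andP; split; first exact: sup_upper_bound.
  by apply: ge_sup; [exists a|move=> t [/andP[]]].
have [d d0 Hd] := loc c cab.
have Pc : P c.
  have [t At] := sup_adherent d0 supA; rewrite -/c => ct.
  have tc : t <= c by exact: sup_upper_bound.
  have [|_ H] := Hd t; first by rewrite ler0_norm ?subr_le0//; lra.
  by apply: step At.2 (H tc).
move: (cab); rewrite in_itv/= => /andP[ac cb].
suff cbE : c = b.
  move: Pc; rewrite /P cbE => /le_trans; apply.
  rewrite -EFinD lee_fin lerD2l /k.
  have -> : 2 * (e / (2 * (b - a + 1))) * (b - a) =
      e * ((b - a) / (b - a + 1)) by field; rewrite gt_eqF.
  by rewrite ger_pMr// ler_pdivrMr// mul1r lerDl.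
apply/eqP; rewrite eq_le cb/= leNgt; apply/negP => cltb.
pose u := Num.min b (c + d / 2).
have cu : c < u by rewrite lt_min cltb/= ltrDl divr_gt0.
have ucd : u <= c + d / 2 by rewrite ge_min lexx orbT.
have Au : A u.
  split; first by rewrite ge_min lexx/= (le_trans ac)// ltW.
  have [|H _] := Hd u; first by rewrite gtr0_norm ?subr_gt0//; lra.
  by apply: step Pc (H (ltW cu)).
by have := sup_upper_bound supA Au; rewrite leNgt cu.
Qed.

Lemma integral_is_derive (F s : R -> R) (a b : R) : continuous s -> a < b ->
  (forall t, t \in `[a, b] -> is_derive t 1 F (s t)) ->
  (\int[lebesgue_measure]_(t in `[a, b]) (s t)%:E = (F b - F a)%:E)%E.
Proof.
move=> cs ab dF; rewrite (@continuous_FTC2 _ s F)//.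
- exact: continuous_subspaceT.
- have cF (t : R) : t \in `[a, b] -> {for t, continuous F}.
    move=> /dF[dt _]; apply: differentiable_continuous.
    exact/derivable1_diffP.
  split.
  + by move=> t /subset_itv_oo_cc /dF[].
  + by apply: cvg_at_right_filter; apply: cF; rewrite in_itv/= lexx ltW.
  + by apply: cvg_at_left_filter; apply: cF; rewrite in_itv/= lexx ltW.
- by move=> t /subset_itv_oo_cc /dF[_ Fs]; rewrite derive1E.
Qed.

Lemma continuous_antiderivative (s : R -> R) (a b : R) :
  continuous s -> a < b -> exists2 F : R -> R,
    (forall t, t \in `[a, b] -> is_derive t 1 F (s t)) &
    (\int[lebesgue_measure]_(t in `[a, b]) (s t)%:E = (F b - F a)%:E)%E.
Proof.
move=> cs ab.
(* starting the integral before [a] makes [F] differentiable at [a] too *)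
pose F x := (\int[lebesgue_measure]_(t in [set` `[a - 1, x]]) (s t))%R.
have dF (t : R) : t \in `[a, b] -> derivable F t 1 /\ derive1 F t = s t.
  rewrite in_itv/= => /andP[ta tb].
  apply: (@continuous_FTC1_closed _ s (a - 1) t (b + 1)).
  - by lra.
  - apply: continuous_compact_integrable; first exact: segment_compact.
    exact: continuous_subspaceT.
  - by lra.
  - exact: cs.
clearbody F; have {}dF (t : R) : t \in `[a, b] -> is_derive t 1 F (s t).
  by move=> /dF[dt Ft]; apply: DeriveDef => //; rewrite -derive1E.
by exists F => //; exact: integral_is_derive.
Qed.

Lemma integral_itv_eq_inside (f h : R -> R) (p q : R) :
  {in `]p, q[%classic, f =1 h} -> measurable_fun setT h ->
  measurable_fun `[p, q] f /\
  (\int[lebesgue_measure]_(t in `[p, q]) (f t)%:E =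
   \int[lebesgue_measure]_(t in `[p, q]) (h t)%:E)%E.
Proof.
move=> fh mh; have mhoo : measurable_fun `]p, q[ h by exact: measurable_funTS.
have mfoo : measurable_fun `]p, q[ f.
  by apply: eq_measurable_fun mhoo => t tpq; apply: esym; exact: fh.
split; first exact: measurable_fun_itv_cc mfoo.
rewrite integral_itv_bndoo; last exact/measurable_EFinP.
rewrite [RHS]integral_itv_bndoo; last exact/measurable_EFinP.
by apply: eq_integral => t /fh ->.
Qed.

Lemma setU_itvcc (a x b : R) : a < x -> x <= b ->
  `[a, b]%classic = `[a, x] `|` `]x, b].
Proof.
move=> ax xb; apply/seteqP; split=> t /=; rewrite !in_itv/=.
  by move=> /andP[-> ->]; case: leP; [left|right].
move=> [|] /andP[h1 h2]; first by rewrite h1 (le_trans h2).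
by rewrite h2 (le_trans (ltW ax))// ltW.
Qed.

(** Measurability is part of the conclusion because splitting an integral needs
    it, and the speed of a piecewise smooth curve is arbitrary at the ends of
    its pieces. *)
Lemma integral_split (f : R -> R) (a x b : R) : a < x -> x <= b ->
  measurable_fun `[a, x] f -> measurable_fun `[x, b] f ->
  (forall t, 0 <= f t) -> measurable_fun `[a, b] f /\
  (\int[lebesgue_measure]_(t in `[a, b]) (f t)%:E =
   \int[lebesgue_measure]_(t in `[a, x]) (f t)%:E +
   \int[lebesgue_measure]_(t in `[x, b]) (f t)%:E)%E.
Proof.
move=> ax xb max mxb f0; have ab := setU_itvcc ax xb.
have mxb' := measurable_fun_itv_oc mxb.
have mab : measurable_fun `[a, b] f by rewrite ab; apply/measurable_funU.
split=> //; rewrite ab ge0_integral_setU//=.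
- by rewrite integral_itv_obnd_cbnd//; exact/measurable_EFinP.
- by rewrite -ab; exact/measurable_EFinP.
- by move=> t _; rewrite lee_fin.
- rewrite disj_set2E; apply/eqP/seteqP; split=> // t [] /=.
  by rewrite !in_itv/= => /andP[_ tx] /andP[/lt_le_trans/(_ tx)]; rewrite ltxx.
Qed.

End Growth.

(** * The metric in coordinates *)
Section MetricInCharts.
Context {R : realType} {M : manifold R} (g : rmetric M).

(** The metric in the coordinates of [c].  A tangent vector is encoded in the
    chart chosen around its own base point, hence the change of coordinates. *)
Definition chart_ip (c : chart R M (mdim M)) (y v w : 'T M) : R :=
  let x := cinv c y in
  let J := 'd (mchart M x \o cinv c) y in g x (J v) (J w).

Lemma ip_suml x n (a : 'I_n -> R) (u : 'I_n -> 'T M) w :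
  g x (\sum_i a i *: u i) w = \sum_i a i * g x (u i) w.
Proof.
elim/big_rec2 : _ => [|i y1 y2 _ IH]; first exact: ip0l.
by rewrite ipDl ipZl IH.
Qed.

Lemma cvg_big_add (T : topologicalType) n (f : 'I_n -> T -> R) (p : T) :
  (forall i, {for p, continuous (f i)}) ->
  {for p, continuous (fun q => \sum_i f i q)}.
Proof.
by move=> cf; apply: cvg_big => //; [exact: add_continuous|move=> i _; exact: cf].
Qed.

Lemma chart_ipE c y v : chart_ip c y v v =
  \sum_i \sum_j v 0 i * (v 0 j * chart_ip c y (delta_mx 0 i) (delta_mx 0 j)).
Proof.
rewrite /chart_ip; set J := 'd _ y.
have -> : J v = \sum_i v 0 i *: J (delta_mx 0 i) by exact: linear_rV_coord.
rewrite ip_suml; apply: eq_bigr => i _.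
by rewrite ip_sym ip_suml mulr_sumr; apply: eq_bigr => j _; rewrite ip_sym.
Qed.

(** The metric is smooth for constant vectors, and joint continuity in the
    vector follows from expanding it on the basis. *)
Lemma chart_ip_continuous c y v : matlas M c -> (c @` cdom c) y ->
  {for (y, v), continuous (fun p : 'T M * 'T M => chart_ip c p.1 p.2 p.2)}.
Proof.
move=> ac cy.
have -> : (fun p : 'T M * 'T M => chart_ip c p.1 p.2 p.2) =
    (fun p => \sum_i \sum_j p.2 0 i *
      (p.2 0 j * chart_ip c p.1 (delta_mx 0 i) (delta_mx 0 j))).
  by apply/funext => p; exact: chart_ipE.
have cc i : {for (y, v), continuous (fun p : 'T M * 'T M => p.2 0 i)}.
  apply: (@continuous_comp _ _ _ snd (fun w : 'T M => w 0 i)).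
    exact: cvg_snd.
  exact: coord_continuous.
apply: cvg_big_add => i; apply: cvg_big_add => j.
apply: cvgM; first exact: cc.
apply: cvgM; first exact: cc.
apply: (@continuous_comp _ _ _ fst
  (fun y => chart_ip c y (delta_mx 0 i) (delta_mx 0 j))).
  exact: cvg_fst.
have := ip_smooth g (delta_mx 0 i) (delta_mx 0 j) ac 0%N.
by apply; rewrite inE.
Qed.

End MetricInCharts.

(** * Speed and length of curves *)
Section Speed.
Context {R : realType} {M : manifold R} (g : rmetric M).
Implicit Types (c e : R -> M).

Definition speed c (t : R) : R :=
  Num.sqrt (g (c t) (velocity c t) (velocity c t)).

Lemma velocity_in_chart e (h : chart R M (mdim M)) t :
  smooth_curve e -> matlas M h -> cdom h (e t) ->
  velocity e t =
  'd (mchart M (e t) \o cinv h) (h (e t)) ('D_1 (h \o e : R -> 'T M) t).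
Proof.
move=> se ah het; have [_ ce ev] := smooth_curve_at t se.
have [/(_ t het) dhe _] := se.2 h ah 1%N.
have [+ _] := atlas_smooth ah (chart_at_atlas (mstr M) (e t)) 1%N.
move=> /(_ (h (e t))) dtr.
have {}dtr : differentiable (mchart M (e t) \o cinv h) (h (e t)).
  by apply: dtr; exists (e t) => //; split=> //; exact: chart_at_dom.
have := expands_comp (diff_continuous dtr) (differentiable_fderiv dtr)
  (differentiable_expands dhe).
move=> E; apply: expands_uniq ev _; apply: expands_near_eq E.
have het' : nbhs (e t) (cdom h).
  by apply: open_nbhs_nbhs; split=> //; exact: cdom_open.
have hu : \forall u \near t, cdom h (e u) := ce _ het'.
by apply: filterS hu => u hu /=; rewrite cfunK// inE.
Qed.

Lemma speed_in_chart e (h : chart R M (mdim M)) t :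
  smooth_curve e -> matlas M h -> cdom h (e t) ->
  speed e t = Num.sqrt (chart_ip g h (h (e t))
    ('D_1 (h \o e : R -> 'T M) t) ('D_1 (h \o e : R -> 'T M) t)).
Proof.
move=> se ah het; rewrite /speed (velocity_in_chart se ah het) /chart_ip.
by rewrite cfunK// inE.
Qed.

(** The encoding of the velocity changes with the base point of the curve, so
    continuity is read off in the coordinates of one fixed chart. *)
Lemma speed_continuous e : smooth_curve e -> continuous (speed e).
Proof.
move=> se t; pose h := mchart M (e t).
have ah : matlas M h := chart_at_atlas _ _.
have het : cdom h (e t) := chart_at_dom _ _.
have near_h : \forall u \near t, cdom h (e u).
  by apply: se.1; apply: open_nbhs_nbhs; split=> //; exact: cdom_open.
pose D := 'D_1 (h \o e : R -> 'T M).
pose s u := Num.sqrt (chart_ip g h (h (e u)) (D u) (D u)).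
have [dhe /(_ 1) cD] := se.2 h ah 1%N.
have cs : {for t, continuous s}.
  apply: continuous_comp; last exact: sqrt_continuous.
  have cp : {for t, continuous (fun u : R => (h (e u), D u) : 'T M * 'T M)}.
    have c1 := differentiable_continuous (dhe t het).
    have c2 : {for t, continuous D} by apply: cD; rewrite inE.
    exact: (cvg_pair c1 c2).
  have ci : {for ((h (e t), D t) : 'T M * 'T M),
      continuous (fun p : 'T M * 'T M => chart_ip g h p.1 p.2 p.2)}.
    by apply: chart_ip_continuous => //; exists (e t).
  exact: (continuous_comp cp ci).
have E : \forall u \near t, s u = speed e u.
  by apply: filterS near_h => u hu; rewrite (speed_in_chart se ah hu).
rewrite /continuous_at -(nbhs_singleton E).
by apply: cvg_trans cs; apply: near_eq_cvg; apply: filterS E => u ->.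
Qed.

Lemma speed_near_eq c e t : (\forall u \near t, c u = e u) ->
  speed c t = speed e t.
Proof.
move=> ce; have cet := nbhs_singleton ce; rewrite /speed /velocity cet.
suff -> : derive1 (fun u : R => mchart M (e t) (c u)) t =
    derive1 (fun u : R => mchart M (e t) (e u)) t by [].
rewrite !derive1E; apply: near_eq_derive.
by apply: filterS ce => u ->.
Qed.

(** The velocities of [c] and of [e] may differ at [p] and [q], where the curves
    agree on one side only; two points do not change the integral. *)
Lemma speed_piece c e (p q : R) : p < q -> smooth_curve e ->
  {in `[p, q], c =1 e} -> measurable_fun `[p, q] (speed c) /\
  (\int[lebesgue_measure]_(t in `[p, q]) (speed c t)%:E =
   \int[lebesgue_measure]_(t in `[p, q]) (speed e t)%:E)%E.
Proof.
move=> pq se ce.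
have E : {in `]p, q[%classic, speed c =1 speed e}.
  move=> t; rewrite inE => tpq; apply: speed_near_eq.
  have : nbhs t `]p, q[%classic by apply: open_nbhs_nbhs; split=> //; exact: interval_open.
  by apply: filterS => u /= /subset_itv_oo_cc; exact: ce.
have mse : measurable_fun setT (speed e).
  by apply: continuous_measurable_fun; exact: speed_continuous.
exact: integral_itv_eq_inside E mse.
Qed.

Lemma le_length_pieces (E : M -> M -> \bar R) c (s : seq R) (a b : R) :
  (forall x, E x x <= 0)%E -> (forall x y z, E x z <= E x y + E y z)%E ->
  (forall e (p q : R), smooth_curve e -> (p < q)%R ->
    E (e p) (e q) <= \int[lebesgue_measure]_(t in `[p, q]) (speed e t)%:E)%E ->
  itv_partition a b s -> (forall i : nat, (i < size s)%N ->
      exists2 e : R -> M, smooth_curve e &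
        {in `[nth 0 (a :: s) i, nth 0 (a :: s) i.+1], c =1 e}) ->
  measurable_fun `[a, b] (speed c) /\
  (E (c a) (c b) <= \int[lebesgue_measure]_(t in `[a, b]) (speed c t)%:E)%E.
Proof.
move=> E0 Etri Ee; elim: s a => [|x s IH] a abs pieces.
  rewrite (itv_partition_nil abs) set_itv1; split.
    exact: measurable_fun_set1.
  by rewrite integral_set1.
have /andP[ax _] : (a < x) && path <%R x s by case: abs.
have xb := itv_partition_le (itv_partition_cons abs).
have [e se /= ce] := pieces 0%N isT.
have caE : c a = e a by apply: ce; rewrite in_itv/= lexx; exact: ltW.
have cxE : c x = e x by apply: ce; rewrite in_itv/= lexx andbT; exact: ltW.
have [max Iax] := speed_piece ax se ce.
have [|mxb Exb] := IH x (itv_partition_cons abs).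
  by move=> i is_; have := pieces i.+1 is_.
have [mab ->] := integral_split ax xb max mxb (fun t => sqrtr_ge0 _).
split; first exact: mab.
rewrite Iax; apply: le_trans (Etri _ (c x) _) _; apply: leeD; last exact: Exb.
by rewrite caE cxE; exact: Ee.
Qed.

(** On each smooth piece of a curve the speed is continuous, so its integral is
    the increment of a primitive, to which [growth_le] compares [E]. *)
Lemma le_riemannian_dist (E : M -> M -> \bar R) :
  (forall x, E x x <= 0)%E -> (forall x y z, E x z <= E x y + E y z)%E ->
  (forall e t r, smooth_curve e -> 0 < r -> \forall u \near t,
    (E (e t) (e u) <= ((speed e t + r) * `|u - t|)%:E)%E /\
    (E (e u) (e t) <= ((speed e t + r) * `|u - t|)%:E)%E) ->
  forall x y, (E x y <= riemannian_dist g x y)%E.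
Proof.
move=> E0 Etri Ee x y; apply: le_ereal_inf_tmp => _ [c [[s s01 pieces] c0 c1] <-].
rewrite -c0 -c1.
apply: (le_length_pieces E0 Etri _ s01 pieces).2 => e p q se pq.
have [F dF ->] := continuous_antiderivative (speed_continuous se) pq.
apply: (growth_le (E := fun t u => E (e t) (e u)) (ltW pq) _ dF) => //.
by move=> t r _ r0; exact: Ee.
Qed.

End Speed.

(** * The normal pseudo-distance between points *)
Section ChainDistance.
Context {R : realType} {G : lie_groupoid R} (eta : groupoid_metric G).
Local Notation M := (obj G).
Local Notation g := (eta0 eta).
Local Open Scope ereal_scope.

Lemma curve_length_ge0 (c : R -> M) : 0 <= curve_length g c.
Proof. by apply: integral_ge0 => t _; rewrite lee_fin sqrtr_ge0. Qed.

Lemma riemannian_dist_ge0 (x y : M) : 0 <= riemannian_dist g x y.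
Proof.
by apply: le_ereal_inf_tmp => _ [c _ <-]; exact: curve_length_ge0.
Qed.

Definition chain_length (n : nat) (c : nat -> M) : \bar R :=
  \sum_(1 <= i < n.+1) riemannian_dist g (c i.*2.-1) (c i.*2).

Lemma chain_length_ge0 n c : 0 <= chain_length n c.
Proof. by apply: sume_ge0 => i _; exact: riemannian_dist_ge0. Qed.

Lemma chain_dist_le n c (x y : M) : chain n c x y ->
  chain_dist eta x y <= chain_length n c.
Proof. by move=> cxy; apply: ereal_inf_lbound; exists n, c. Qed.

Lemma chain_dist_ge0 (x y : M) : 0 <= chain_dist eta x y.
Proof.
by apply: le_ereal_inf_tmp => _ [n [c [_ ->]]]; exact: chain_length_ge0.
Qed.

(** The last point of [c] and the first one of [c'] are dropped: the last orbit
    step of [c] and the first one of [c'] merge into one. *)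
Definition chain_cat n (c c' : nat -> M) (i : nat) : M :=
  if (i <= n.*2)%N then c i else c' (i - n.*2)%N.

Lemma chain_catP n m c c' (x y z : M) : chain n c x y -> chain m c' y z ->
  chain (n + m) (chain_cat n c c') x z.
Proof.
move=> [c0 cn co cc] [c0' cm' co' cc']; split.
- by rewrite /chain_cat.
- rewrite /chain_cat ifF; last by lia.
  by have -> : ((n + m).*2.+1 - n.*2 = m.*2.+1)%N by lia.
- move=> i inm; rewrite /chain_cat leq_double ltn_double.
  have [ilt|igt|->] := ltngtP i n.
  + exact/co/ltnW.
  + have -> : (i.*2.+1 - n.*2 = (i - n).*2.+1)%N by lia.
    have -> : (i.*2 - n.*2 = (i - n).*2)%N by lia.
    by apply: co'; lia.
  + rewrite subSnn; apply: orbit_rel_trans (co n (leqnn n)) _.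
    by rewrite cn -c0'; exact: (co' 0%N).
- move=> i /andP[i0 inm]; rewrite /chain_cat leq_double.
  have [ile|igt] := leqP i n.
    by rewrite ifT; [apply: cc; rewrite i0|lia].
  rewrite ifF; last by lia.
  have -> : (i.*2.-1 - n.*2 = (i - n).*2.-1)%N by lia.
  have -> : (i.*2 - n.*2 = (i - n).*2)%N by lia.
  by apply: cc'; lia.
Qed.

Lemma chain_length_cat n m c c' :
  chain_length (n + m) (chain_cat n c c') = chain_length n c + chain_length m c'.
Proof.
rewrite /chain_length (@big_cat_nat _ _ _ n.+1)//=; last by lia.
congr (_ + _).
  apply: eq_big_nat => i /andP[i0 ile]; rewrite /chain_cat !ifT//; lia.
rewrite -addn1 addnC big_addn; have -> : ((n + m).+1 - n = m.+1)%N by lia.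
apply: eq_big_nat => i /andP[i0 ile]; rewrite /chain_cat !ifF; [|lia..].
by congr (riemannian_dist g (c' _) (c' _)); lia.
Qed.

Lemma chain_dist_triangle (x y z : M) :
  chain_dist eta x z <= chain_dist eta x y + chain_dist eta y z.
Proof.
have [->|xy] := eqVneq (chain_dist eta x y) +oo.
  by rewrite addye ?leey// gt_eqF// (lt_le_trans _ (chain_dist_ge0 _ _)).
have [->|yz] := eqVneq (chain_dist eta y z) +oo.
  by rewrite addey ?leey// gt_eqF// (lt_le_trans _ (chain_dist_ge0 _ _)).
have fxy : chain_dist eta x y \is a fin_num by rewrite ge0_fin_numE ?chain_dist_ge0// ltey.
have fyz : chain_dist eta y z \is a fin_num by rewrite ge0_fin_numE ?chain_dist_ge0// ltey.
apply/lee_addgt0Pr => e e0.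
have e20 : (0 < e / 2)%R by rewrite divr_gt0.
have [_ [n [c [cxy ->]]] lxy] := lb_ereal_inf_adherent e20 fxy.
have [_ [m [c' [cyz ->]]] lyz] := lb_ereal_inf_adherent e20 fyz.
apply: le_trans (chain_dist_le (chain_catP cxy cyz)) _.
rewrite chain_length_cat (splitr e) EFinD addeACA.
by apply: leeD; exact: ltW.
Qed.

Lemma chain_dist_orbit0 (x y : M) : orbit_rel x y -> chain_dist eta x y <= 0.
Proof.
move=> xy; apply: le_trans (chain_dist_le (n := 0) (c := fun i => if i == 0%N then x else y) _) _.
  by split=> // [i|i]; [rewrite leqn0 => /eqP ->|lia].
by rewrite /chain_length big_geq.
Qed.

(** A single smooth curve gives a chain with trivial orbit steps; its image is
    connected, so that its ends lie in the same component. *)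
Lemma chain_dist_curve (e : R -> M) : smooth_curve e ->
  chain_dist eta (e 0%R) (e 1%R) <= curve_length g e.
Proof.
move=> se; pose c i := if (i <= 1)%N then e 0%R else e 1%R.
apply: le_trans (chain_dist_le (n := 1) (c := c) _) _.
  split=> // [[|[|i]]//= _|i]; try exact: orbit_rel_refl.
    case: i => [|[|i]]//= _.
    exists (range e); last by exists 1%R.
    split; [by exists 0%R|by []|].
    apply: connected_continuous_connected; last exact/continuous_subspaceT/se.1.
    rewrite -set_itvNyy; apply/connected_intervalP; exact: interval_is_interval.
rewrite /chain_length big_nat1; apply: ereal_inf_lbound; exists e => //; split=> //.
exists [:: 1%R]; first by apply: itv_partition1.
by case=> // _; exists e.
Qed.

(** The three assumptions bound [E] by the length of each chain, one step at a
    time. *)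
Lemma chain_dist_greatest (E : M -> M -> \bar R) :
  (forall x y z, E x z <= E x y + E y z) ->
  (forall x y, orbit_rel x y -> E x y <= 0) ->
  (forall x y, E x y <= riemannian_dist g x y) ->
  forall x y, E x y <= chain_dist eta x y.
Proof.
move=> Etri Eorb Edist x y; apply: le_ereal_inf_tmp => _ [n [c [[<- <- co cc] ->]]].
elim: n co {cc} => [|n IH] co; first by rewrite big_geq// Eorb// (co 0%N).
rewrite big_nat_recr//=.
apply: le_trans (Etri _ (c n.*2.+1) _) _; apply: leeD.
  by apply: IH => i ile; apply: co; rewrite ltnW.
apply: le_trans (Etri _ (c n.+1.*2) _) _.
by rewrite -[leRHS]adde0; apply: leeD; [exact: Edist|apply: Eorb; exact: (co n.+1)].
Qed.

End ChainDistance.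

(** * Short segments in a chart *)
Section ShortSegments.
Context {R : realType}.

Lemma integral_le_ramp (s : R -> R) (k : R) : continuous s ->
  (forall t, 0 <= s t) -> (forall t, t \in `[0, 1] -> s t <= k * dramp t) ->
  (\int[lebesgue_measure]_(t in `[0%R, 1%R]) (s t)%:E <= k%:E)%E.
Proof.
move=> cs s0 sk.
have ck : continuous (fun t : R => k * dramp t).
  exact: trig_continuous (trigM (trig_cst k) trig_dramp).
have dk (t : R) : t \in `[0, 1] ->
    is_derive t 1 (fun t => k * ramp t) (k * dramp t).
  move=> _; have := is_deriveM (is_derive_cst k t 1) (is_derive_ramp t).
  by rewrite scaler0 addr0.
have -> : k = k * ramp 1 - k * ramp 0 by rewrite ramp0 ramp1 mulr0 mulr1 subr0.
rewrite -(integral_is_derive ck ltr01 dk).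
apply: ge0_le_integral => //.
- by move=> t _; rewrite lee_fin.
- by apply/measurable_EFinP; apply: measurable_funTS; exact: continuous_measurable_fun.
- by apply/measurable_EFinP; apply: measurable_funTS; exact: continuous_measurable_fun.
Qed.

Context {M : manifold R} (g : rmetric M).

Definition ramp_curve (x : M) (p q : 'rV[R]_(mdim M)) (t : R) : M :=
  cinv (mchart M x) (p + ramp t *: (q - p)).

Lemma ramp_curve_smooth (x : M) (p q : 'rV[R]_(mdim M)) :
  (forall t, (mchart M x @` cdom (mchart M x)) (p + ramp t *: (q - p))) ->
  smooth_curve (ramp_curve x p q).
Proof.
set h := mchart M x; move=> hpq.
have cseg : continuous (fun t : R => p + ramp t *: (q - p)).
  move=> t; have := is_derive_scale_mx (is_derive_ramp t) (is_derive_cst (q - p) t 1).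
  move=> H; have [+ _] := is_deriveD (is_derive_cst p t 1) H.
  by move=> /derivable1_diffP/differentiable_continuous.
split=> [t|h' ah' k].
  have ch : {for p + ramp t *: (q - p), continuous (cinv h)}.
    by apply: cinv_continuous; rewrite inE.
  exact: (continuous_comp (cseg t) ch).
pose U := h @` (cdom h `&` cdom h').
have sF : smooth_on U (h' \o cinv h) by apply: atlas_smooth => //; exact: chart_at_atlas.
have oU : open U by apply: open_chart_image; exact: cdom_open.
have := Ck_ramp_segment p (q - p) k oU sF (trig_cst 1).
have -> : [set t : R^o | U (p + ramp t *: (q - p))] = ramp_curve x p q @^-1` cdom h'.
  apply/seteqP; split=> t /=; rewrite /ramp_curve -/h.
    by move=> [z [hz h'z] <-]; rewrite cfunK// inE.
  by move=> h't; exists (cinv h (p + ramp t *: (q - p))); [split=> //; exact: cdom_cinv|exact: cinvK].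
by under eq_fun do rewrite /cst scale1r.
Qed.

(** At the centre of a chart the change of coordinates is the identity near the
    point, so its differential is the identity. *)
Lemma chart_ip_base (x : M) v :
  chart_ip g (mchart M x) (mchart M x x) v v = g x v v.
Proof.
rewrite /chart_ip; set h := mchart M x.
have hx : cdom h x := chart_at_dom _ x.
have -> : cinv h (h x) = x by rewrite cfunK// inE.
have U0 : (h @` cdom h) (h x) by exists x.
have hE : {in h @` cdom h, id =1 h \o cinv h}.
  by move=> y; rewrite inE => hy; rewrite /= cinvK.
have [did idE] := is_diff_id (h x).
have [_ ->] := differentiable_ext (@cimg_open _ _ _ h) hE U0 did.
by rewrite idE.
Qed.

Lemma speed_ramp_curve (x : M) p q t :
  (forall t, (mchart M x @` cdom (mchart M x)) (p + ramp t *: (q - p))) ->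
  speed g (ramp_curve x p q) t = Num.sqrt (chart_ip g (mchart M x)
    (p + ramp t *: (q - p)) (dramp t *: (q - p)) (dramp t *: (q - p))).
Proof.
set h := mchart M x; move=> hpq.
rewrite (speed_in_chart g (h := h))//; last 3 first.
- exact: ramp_curve_smooth.
- exact: chart_at_atlas.
- exact: cdom_cinv.
have hE : h \o ramp_curve x p q = (fun t => p + ramp t *: (q - p)).
  by apply/funext => u; rewrite /= /ramp_curve cinvK.
have H := is_derive_scale_mx (is_derive_ramp t) (is_derive_cst (q - p) t 1).
have [_] := is_deriveD (is_derive_cst p t 1) H.
rewrite scaler0 addr0 add0r hE => ->.
by rewrite /ramp_curve cinvK.
Qed.

Lemma chart_ipZ (h : chart R M (mdim M)) y a v :
  chart_ip g h y (a *: v) (a *: v) = a ^+ 2 * chart_ip g h y v v.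
Proof. by rewrite /chart_ip !linearZ/= ipZl ipZr mulrA expr2. Qed.

End ShortSegments.

(** * Chains along short segments *)
Section SmallChains.
Context {R : realType} {G : lie_groupoid R} (eta : groupoid_metric G).
Local Notation M := (obj G).
Local Notation g := (eta0 eta).

(** The segment from [p] to [q] has velocity close to [tau w], and the metric
    along it is close to the one at [x], by continuity of the norm in both the
    point and the vector. *)
Lemma chain_dist_chart (x : M) (w : 'T M) r : 0 < r ->
  exists2 d : R, 0 < d & forall p q tau,
    `|p - mchart M x x| < d -> `|q - mchart M x x| < d ->
    `|q - p - tau *: w| <= d * `|tau| ->
    (chain_dist eta (cinv (mchart M x) p) (cinv (mchart M x) q) <=
      ((Num.sqrt (g x w w) + r) * `|tau|)%:E)%E.
Proof.
move=> r0; set h := mchart M x; set x0 := h x.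
have hx : cdom h x := chart_at_dom _ x.
have ah : matlas M h := chart_at_atlas _ x.
have [d1 d10 Hd1] := near_norm (nbhs_chart hx).
have cN : {for ((x0, w) : 'T M * 'T M), continuous
    (fun p : 'T M * 'T M => Num.sqrt (chart_ip g h p.1 p.2 p.2))}.
  have c1 : {for ((x0, w) : 'T M * 'T M), continuous
      (fun p : 'T M * 'T M => chart_ip g h p.1 p.2 p.2)}.
    by apply: chart_ip_continuous => //; exists x.
  exact: (continuous_comp c1 (@sqrt_continuous R _)).
have [d2 d20 Hd2] : exists2 d : R, 0 < d & forall y v, `|y - x0| < d ->
    `|v - w| < d -> Num.sqrt (chart_ip g h y v v) <= Num.sqrt (g x w w) + r.
  have /cvgrPdist_lt/(_ r r0) := cN; rewrite /= chart_ip_base => N.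
  have [d d0 H] := near_norm N; exists d => // y v yd vd.
  have := H (y, v); rewrite prod_normE/= gt_max yd vd => /(_ isT).
  by rewrite ltr_norml => /andP[+ _]; lra.
pose d := Num.min d1 d2 / 2.
have d12 : 0 < Num.min d1 d2 by rewrite lt_min d10.
have dd1 : d <= d1 by rewrite /d ler_pdivrMr// ge_min; apply/orP; left; lra.
have dd2 : d < d2.
  by rewrite /d ltr_pdivrMr// gt_min; apply/orP; right; lra.
exists d => [|p q tau pd qd]; first by rewrite divr_gt0.
have [->|tau0] := eqVneq tau 0.
  rewrite scale0r subr0 normr0 !mulr0 normr_le0 subr_eq0 => /eqP ->.
  by apply: chain_dist_orbit0; exact: orbit_rel_refl.
move=> qpd; pose v := tau^-1 *: (q - p).
have qpE : q - p = tau *: v by rewrite /v scalerA divff// scale1r.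
have vw : `|v - w| <= d.
  have tau0' : 0 < `|tau| by rewrite normr_gt0.
  by rewrite -(ler_pM2l tau0') -normrZ scalerBr -qpE mulrC.
have seg t : `|p + ramp t *: (q - p) - x0| < d.
  have /andP[t0 t1] := ramp_itv t.
  exact: segment_in_ball.
have hseg t : (h @` cdom h) (p + ramp t *: (q - p)).
  by apply: Hd1; exact: lt_le_trans (seg t) dd1.
have se := ramp_curve_smooth hseg.
have E0 : ramp_curve x p q 0 = cinv h p.
  by rewrite /ramp_curve ramp0 scale0r addr0.
have E1 : ramp_curve x p q 1 = cinv h q.
  by rewrite /ramp_curve ramp1 scale1r addrC subrK.
have := chain_dist_curve eta se; rewrite E0 E1 => /le_trans; apply.
apply: (@integral_le_ramp _ (speed g (ramp_curve x p q))).
- exact: speed_continuous.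
- by move=> t; exact: sqrtr_ge0.
have key (t : R) : 0 <= t <= 1 -> speed g (ramp_curve x p q) t <=
    (Num.sqrt (g x w w) + r) * `|tau| * dramp t.
  move=> /dramp_ge0 r'0; rewrite speed_ramp_curve//.
  have := seg t; set y := p + _ => yd.
  have -> : dramp t *: (q - p) = (dramp t * tau) *: v by rewrite qpE scalerA.
  rewrite chart_ipZ sqrtrM ?sqr_ge0// sqrtr_sqr normrM (ger0_norm r'0).
  rewrite [leRHS]mulrC mulrA [leRHS]mulrAC -mulrA [leRHS]mulrA.
  have N := Hd2 y v (lt_trans yd dd2) (le_lt_trans vw dd2).
  by apply: ler_wpM2l => //; rewrite mulr_ge0.
by move=> t; rewrite in_itv/=; exact: key.
Qed.

End SmallChains.

(** * Riemannian submersions *)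
Section RiemannianSubmersions.
Context {R : realType}.
Implicit Types M N : manifold R.

Lemma riemannian_submersion_le M N (gM : rmetric M) (gN : rmetric N) f x v :
  riemannian_submersion gM gN f ->
  gN (f x) (tangent_map f x v) (tangent_map f x v) <= gM x v v.
Proof.
move=> [_ fiso].
have [w wK [vwK ->]] := orthogonal_decomposition gM x (lker (tangent_map f x)) v.
have -> : tangent_map f x v = tangent_map f x w.
  by apply/eqP; rewrite -subr_eq0 -linearB -memv_ker.
by rewrite fiso// lerDl ip_ge0.
Qed.

Lemma riemannian_submersion_lift M N (gM : rmetric M) (gN : rmetric N) f x w :
  riemannian_submersion gM gN f ->
  exists2 v, tangent_map f x v = w & gM x v v = gN (f x) w w.
Proof.
move=> [[_ fsurj] fiso].
have : w \in limg (tangent_map f x) by rewrite fsurj memvf.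
move=> /memv_imgP[v0 _ ->].
have [v vK [vvK _]] := orthogonal_decomposition gM x (lker (tangent_map f x)) v0.
have E : tangent_map f x v0 = tangent_map f x v.
  by apply/eqP; rewrite -subr_eq0 -linearB -memv_ker.
by exists v; rewrite E// fiso.
Qed.

Lemma submersion_surj (M N : manifold R) (h : M -> N) x :
  submersion h -> forall w, exists v, tangent_map h x v = w.
Proof.
move=> [_ /(_ x) hx] w; have : w \in limg (tangent_map h x) by rewrite hx memvf.
by move=> /memv_imgP[v _ ->]; exists v.
Qed.

End RiemannianSubmersions.

(** * The invariant metric of a groupoid *)
Section GroupoidMetrics.
Context {R : realType} {G : lie_groupoid R} (eta : groupoid_metric G).
Local Notation gm := (@gmul R G : comp_manifold G -> arr G).

Lemma triangle_swap_continuous : continuous (@triangle_swap R G).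
Proof.
have cf : continuous (@comp_fst R _ _ (@src R G) (@tgt R G)).
  by move=> p; apply: (comp_fst_smooth G).1; rewrite inE.
have cs : continuous (@comp_snd R _ _ (@src R G) (@tgt R G)).
  by move=> p; apply: (comp_snd_smooth G).1; rewrite inE.
have ci : continuous (@ginv R G).
  by move=> p; apply: (ginv_smooth G).1; rewrite inE.
apply: continuous_comp_initial => p.
have c1 := continuous_comp (cs p) (ci _).
have c2 := continuous_comp (cf p) (ci _).
exact: (cvg_pair c1 c2).
Qed.

(** A total composition takes the proof of composability out of the terms, so
    that the groupoid laws can be used for rewriting. *)
Definition comp_total (a b : arr G) : arr G :=
  if pselect (src a = tgt b) is left e then gmul (comp_pair e) else a.

Lemma comp_totalE a b (e : src a = tgt b) : gmul (comp_pair e) = comp_total a b.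
Proof.
rewrite /comp_total; case: pselect => // e'.
by rewrite (Prop_irrelevance e e').
Qed.

Lemma gmul_comp_total (p : comp_manifold G) :
  gm p = comp_total (comp_fst p) (comp_snd p).
Proof.
rewrite -(comp_totalE (comp_pairsP p)); congr (@gmul R G _).
by apply: val_inj => /=; case: p => -[].
Qed.

Lemma comp_totalA a b c : src a = tgt b -> src b = tgt c ->
  comp_total (comp_total a b) c = comp_total a (comp_total b c).
Proof.
move=> ab bc; have abc : src (gmul (comp_pair ab)) = tgt c by rewrite src_gmul.
have abc' : src a = tgt (gmul (comp_pair bc)) by rewrite tgt_gmul.
by have := gmulA abc abc'; rewrite !comp_totalE.
Qed.

Lemma src_comp_total a b : src a = tgt b -> src (comp_total a b) = src b.
Proof. by move=> e; rewrite -(comp_totalE e) src_gmul. Qed.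

Lemma tgt_comp_total a b : src a = tgt b -> tgt (comp_total a b) = tgt a.
Proof. by move=> e; rewrite -(comp_totalE e) tgt_gmul. Qed.

Lemma comp_totalVl a : comp_total (ginv a) a = gunit (src a).
Proof. by rewrite -(comp_totalE (src_ginv a)) gmul_invl. Qed.

Lemma comp_totalVr a : comp_total a (ginv a) = gunit (tgt a).
Proof. by rewrite -(comp_totalE (esym (tgt_ginv a))) gmul_invr. Qed.

Lemma comp_total1l a : comp_total (gunit (tgt a)) a = a.
Proof. by rewrite -(comp_totalE (src_gunit (tgt a))) gmul_unitl. Qed.

Lemma comp_total1r a : comp_total a (gunit (src a)) = a.
Proof. by rewrite -(comp_totalE (esym (tgt_gunit (src a)))) gmul_unitr. Qed.

Lemma ginv_comp_total a b : src a = tgt b ->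
  ginv (comp_total a b) = comp_total (ginv b) (ginv a).
Proof.
move=> ab; set x := comp_total a b; set y := comp_total _ _.
have ba : src (ginv b) = tgt (ginv a) by rewrite src_ginv tgt_ginv.
have ty : tgt y = src b by rewrite (tgt_comp_total ba) tgt_ginv.
have ex : src x = tgt y by rewrite (src_comp_total ab) ty.
have xy : comp_total x y = gunit (tgt x).
  rewrite (comp_totalA ab (esym ty)) -(comp_totalA (esym (tgt_ginv b)) ba).
  rewrite comp_totalVr -ab -(tgt_ginv a) comp_total1l comp_totalVr.
  by rewrite (tgt_comp_total ab).
have := comp_totalA (src_ginv x) ex.
rewrite xy comp_totalVl ex comp_total1l -(src_ginv x) comp_total1r.
by move->.
Qed.

Lemma ginv_gmul (p : comp_manifold G) : ginv (gm p) = gm (triangle_swap p).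
Proof. by rewrite !gmul_comp_total ginv_comp_total//; exact: comp_pairsP. Qed.

(** Write [a] as the product [a 1] and lift [b] horizontally through the
    multiplication.  The inverse of a product is the product of the swapped pair
    of inverses; the swap preserves the metric on pairs, and multiplication does
    not increase norms. *)
Lemma ginv_tangent_le (a : arr G) (b : 'T (arr G)) :
  eta1 eta (ginv a) (tangent_map (@ginv R G) a b) (tangent_map (@ginv R G) a b)
  <= eta1 eta a b b.
Proof.
have e1 : src a = tgt (gunit (src a)) by rewrite tgt_gunit.
pose p : comp_manifold G := comp_pair e1.
have mp : gm p = a by exact: gmul_unitr.
have [V dV nV] := riemannian_submersion_lift p b (eta1_gmul eta).
have [V0|V0] := eqVneq V 0.
  by rewrite -dV V0 !linear0 !ip0l.
have nVs := eta2_swap eta p V V.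
have ds : mdiff (@triangle_swap R G) p.
  split; first exact: triangle_swap_continuous.
  (* the differential of a map that is not differentiable is zero, whereas the
     swap preserves the positive norm of [V] *)
  apply: contrapT => /(@diff_not_differentiable _ _ _ _ _ V).
  rewrite -tangent_mapE => Z; move: nVs; rewrite Z ip0l => /esym/ip_eq0/eqP.
  by rewrite (negbTE V0).
have di : mdiff (@ginv R G) (gm p) by apply: smooth_map_mdiff; exact: ginv_smooth.
have dm q : mdiff gm q by apply: smooth_map_mdiff; exact: gmul_smooth.
have E := tangent_map_comm V erefl erefl (dm p) di ds (dm _) ginv_gmul.
have := riemannian_submersion_le (triangle_swap p)
  (tangent_map (@triangle_swap R G) p V) (eta1_gmul eta).
by rewrite -E -ginv_gmul nVs nV dV mp.
Qed.

(** The lift is horizontal for the source map.  The target map is the source map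
    of the inverse arrow, and neither inversion nor the source map increases
    norms. *)
Lemma src_lift (a : arr G) (v : 'T (obj G)) :
  exists2 b, tangent_map (@src R G) a b = v &
    eta0 eta (tgt a) (tangent_map (@tgt R G) a b) (tangent_map (@tgt R G) a b)
    <= eta0 eta (src a) v v.
Proof.
have [b db nb] := riemannian_submersion_lift a v (eta0_src eta).
exists b => //; rewrite -nb; apply: le_trans (ginv_tangent_le a b).
have di : mdiff (@ginv R G) a by apply: smooth_map_mdiff; exact: ginv_smooth.
have dt : mdiff (@tgt R G) a.
  by apply: smooth_map_mdiff; have [] := tgt_submersion G.
have dsr : mdiff (@src R G) (ginv a).
  by apply: smooth_map_mdiff; have [] := src_submersion G.
have E := tangent_map_comp b di dsr dt (@src_ginv R G).
have Q := riemannian_submersion_le (ginv a) (tangent_map (@ginv R G) a b)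
  (eta0_src eta).
set X := eta1 eta (ginv a) _ _ in Q *.
suff H z Y : z = tgt a -> Y = tangent_map (@tgt R G) a b ->
    eta0 eta z Y Y <= X -> eta0 eta (tgt a) (tangent_map (@tgt R G) a b)
      (tangent_map (@tgt R G) a b) <= X by exact: H (src_ginv a) E Q.
by move=> -> ->.
Qed.

End GroupoidMetrics.

(** * Normal spaces of orbits *)
Section OrbitDirections.
Context {R : realType} {G : lie_groupoid R}.
Local Notation M := (obj G).

Lemma src_mdiff (a : arr G) : mdiff (@src R G) a.
Proof. by apply: smooth_map_mdiff; have [] := src_submersion G. Qed.

Lemma tgt_mdiff (a : arr G) : mdiff (@tgt R G) a.
Proof. by apply: smooth_map_mdiff; have [] := tgt_submersion G. Qed.

Lemma gunit_mdiff (x : M) : mdiff (@gunit R G) x.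
Proof. by apply: smooth_map_mdiff; exact: gunit_smooth. Qed.

Lemma orbit_rel_arrow (K : lie_groupoid R) (a : arr K) :
  orbit_rel (src a) (tgt a).
Proof. by apply/asboolP; exists a. Qed.

Lemma orbit_tangentP (x : M) u : reflect
  (exists2 xi, tangent_map (@src R G) (gunit x) xi = 0 &
               tangent_map (@tgt R G) (gunit x) xi = u)
  (u \in orbit_tangent x).
Proof.
apply: (iffP memv_imgP) => [[xi + ->]|[xi + <-]].
  by rewrite memv_ker => /eqP; exists xi.
by move=> sxi; exists xi => //; rewrite memv_ker sxi.
Qed.

(** Vectors along the units have equal images under the two maps, and vectors
    tangent to the source fibre account for the difference. *)
Lemma unit_lift (x : M) (v w : 'T M) : v - w \in orbit_tangent x ->
  exists2 zeta, tangent_map (@src R G) (gunit x) zeta = v &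
                tangent_map (@tgt R G) (gunit x) zeta = w.
Proof.
move=> /orbit_tangentP[xi sxi txi].
have sv := tangent_map_cancel v (gunit_mdiff x) (src_mdiff _) (@src_gunit R G).
have tv := tangent_map_cancel v (gunit_mdiff x) (tgt_mdiff _) (@tgt_gunit R G).
exists (tangent_map (@gunit R G) x v - xi).
  by rewrite linearB/= sv sxi subr0.
by rewrite linearB/= tv txi subKr.
Qed.

Lemma normal_classP (x : M) (v w : 'T M) :
  normal_class x v = normal_class x w <-> v - w \in orbit_tangent x.
Proof.
rewrite /normal_class; split=> [/eqP|vw].
  by rewrite -Quotient.idealrBE.
by apply/eqP; rewrite -Quotient.idealrBE.
Qed.

Lemma normal_reprK (x : M) : cancel (@normal_repr R G x) (normal_class x).
Proof. by move=> q; exact: reprK. Qed.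

Context (eta : groupoid_metric G).
Local Notation g := (eta0 eta).

Lemma perp_partP (x : M) v :
  orthogonal_to g x (orbit_tangent x) (perp_part eta x v) /\
  v - perp_part eta x v \in orbit_tangent x.
Proof.
apply: (@xgetPex _ 0 [set w | orthogonal_to g x (orbit_tangent x) w /\
                  v - w \in orbit_tangent x]).
by have [w wO [vw _]] := orthogonal_decomposition g x (orbit_tangent x) v; exists w.
Qed.

Lemma orthogonal_le (x : M) (U : {vspace 'T M}) v w :
  orthogonal_to g x U w -> v - w \in U -> g x w w <= g x v v.
Proof.
move=> wU vw; have -> : g x v v = g x (w + (v - w)) (w + (v - w)).
  by rewrite addrC subrK.
move: (v - w) vw => u uU.
by rewrite ipDl !ipDr (ip_sym g x u w) (wU _ uU) addr0 add0r lerDl ip_ge0.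
Qed.

(** The normal norm is the least norm among the representatives of a class; the
    minimum is attained by [normal_ip_attained]. *)
Lemma normal_ip_le (x : M) v :
  normal_ip eta (normal_class x v) (normal_class x v) <= g x v v.
Proof.
set q := normal_class x v; have [wO rw] := perp_partP x (normal_repr q).
apply: orthogonal_le wO _.
have rv : v - normal_repr q \in orbit_tangent x.
  by apply/normal_classP; rewrite normal_reprK.
by have := memvD rv rw; rewrite addrA subrK.
Qed.

Lemma normal_ip_attained (x : M) q : exists2 w, normal_class x w = q &
  g x w w = normal_ip eta q q.
Proof.
have [_ rw] := perp_partP x (normal_repr q).
exists (perp_part eta x (normal_repr q)) => //.
by rewrite -[RHS]normal_reprK; apply/esym/normal_classP.
Qed.

End OrbitDirections.

(** * Normal vectors under a Riemannian Morita map *)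
Section MoritaDirections.
Context {R : realType} {H G : lie_groupoid R}.
Context (etaH : groupoid_metric H) (eta : groupoid_metric G).
Context (f : groupoid_map H G) (fM : riemannian_morita etaH eta f).

Lemma fobj_mdiff x : mdiff (fobj f) x.
Proof. by apply: smooth_map_mdiff; exact: fobj_smooth. Qed.

Lemma tangent_orbit (x : obj H) u : u \in orbit_tangent x ->
  tangent_map (fobj f) x u \in orbit_tangent (fobj f x).
Proof.
move=> /orbit_tangentP[xi sxi txi]; apply/orbit_tangentP.
have df a : mdiff (farr f) a by apply: smooth_map_mdiff; exact: farr_smooth.
have Es := tangent_map_comm xi (farr_gunit f x) (src_gunit x) (df _)
  (src_mdiff _) (src_mdiff _) (fobj_mdiff x) (farr_src f).
have Et := tangent_map_comm xi (farr_gunit f x) (tgt_gunit x) (df _)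
  (tgt_mdiff _) (tgt_mdiff _) (fobj_mdiff x) (farr_tgt f).
exists (tangent_map (farr f) (gunit x) xi); first by rewrite Es sxi linear0.
by rewrite Et txi.
Qed.

Lemma normal_map_class (x : obj H) v :
  normal_map f (normal_class x v) =
  normal_class (fobj f x) (tangent_map (fobj f) x v).
Proof.
rewrite /normal_map; apply/normal_classP; rewrite -linearB.
by apply: tangent_orbit; apply/normal_classP; rewrite normal_reprK.
Qed.

(** The shortest representative of the image of the class of [v]; its norm is
    the norm of that class, hence that of the class of [v] by isometry. *)
Lemma push_normal (x : obj H) (v : 'T (obj H)) : exists2 w,
  tangent_map (fobj f) x v - w \in orbit_tangent (fobj f x) &
  eta0 eta (fobj f x) w w <= eta0 etaH x v v.
Proof.
have [w wE nw] := normal_ip_attained eta (normal_map f (normal_class x v)).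
exists w; first by apply/normal_classP; rewrite wE normal_map_class.
by rewrite nw fM.2; exact: normal_ip_le.
Qed.

Lemma pull_normal (x : obj H) (v : 'T (obj G)) : exists2 w,
  tangent_map (fobj f) x w - v \in orbit_tangent (fobj f x) &
  eta0 etaH x w w <= eta0 eta (fobj f x) v v.
Proof.
have [[_ _ /(_ x)[k _ kK]] isom] := fM.
have [w wE nw] := normal_ip_attained etaH (k (normal_class (fobj f x) v)).
exists w; first by apply/normal_classP; rewrite -normal_map_class wE kK.
by rewrite nw -isom kK; exact: normal_ip_le.
Qed.

End MoritaDirections.

(** * The equations of a lifted chain *)
Section ChainSystem.
Context {R : realType} (V1 V2 V3 : normedModType R) (n1 n2 n3 : nat).

(** The equations [f1 x = f2 k], [f3 k = f4 b] and [f5 b = c], for unknowns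
    [(x, (k, b))], say that this system takes the value [(0, (0, c))].  Here [x]
    stands for a point and [k], [b] for arrows in charts; the intermediate
    objects [f1 x] and [f3 k] join them into a path of arrows. *)
Definition chain_system (f1 : V1 -> 'rV[R]_n1) (f2 : V2 -> 'rV[R]_n1)
    (f3 : V2 -> 'rV[R]_n2) (f4 : V3 -> 'rV[R]_n2) (f5 : V3 -> 'rV[R]_n3)
    (p : V1 * (V2 * V3)) : 'rV[R]_(n1 + (n2 + n3)) :=
  row_mx (f1 p.1 - f2 p.2.1) (row_mx (f3 p.2.1 - f4 p.2.2) (f5 p.2.2)).

Lemma chain_systemP f1 f2 f3 f4 f5 p a b c :
  chain_system f1 f2 f3 f4 f5 p = row_mx a (row_mx b c) <->
  [/\ f1 p.1 = a + f2 p.2.1, f3 p.2.1 = b + f4 p.2.2 & f5 p.2.2 = c].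
Proof.
split=> [/eq_row_mx[<- /eq_row_mx[<- e3]]|[e1 e2 e3]]; first by rewrite !subrK.
by rewrite /chain_system e1 e2 e3 !addrK.
Qed.

Lemma strict_diff_chain_system f1 f2 f3 f4 f5 x1 x2 x3 L1 L2 L3 L4 L5 :
  strict_diff f1 x1 L1 -> strict_diff f2 x2 L2 -> strict_diff f3 x2 L3 ->
  strict_diff f4 x3 L4 -> strict_diff f5 x3 L5 ->
  strict_diff (chain_system f1 f2 f3 f4 f5) (x1, (x2, x3))
    (chain_system L1 L2 L3 L4 L5).
Proof.
move=> d1 d2 d3 d4 d5.
pose V : normedModType R := (V1 * (V2 * V3))%type.
have N1 (p : V) : `|p.1| <= `|p| by rewrite [leRHS]prod_normE le_max lexx.
have N (p : V) : `|p.2| <= `|p| by rewrite [leRHS]prod_normE le_max lexx orbT.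
have N2 (p : V) : `|p.2.1| <= `|p|.
  by apply: le_trans (N p); rewrite [leRHS]prod_normE le_max lexx.
have N3 (p : V) : `|p.2.2| <= `|p|.
  by apply: le_trans (N p); rewrite [leRHS]prod_normE le_max lexx orbT.
apply: strict_diff_row_mx; [|apply: strict_diff_row_mx].
- apply: strict_diffB.
    exact: (@strict_diff_precomp _ V _ _ fst f1 (x1, (x2, x3)) L1).
  exact: (@strict_diff_precomp _ V _ _ (fun p => p.2.1) f2 (x1, (x2, x3)) L2).
- apply: strict_diffB.
    exact: (@strict_diff_precomp _ V _ _ (fun p => p.2.1) f3 (x1, (x2, x3)) L3).
  exact: (@strict_diff_precomp _ V _ _ (fun p => p.2.2) f4 (x1, (x2, x3)) L4).
- exact: (@strict_diff_precomp _ V _ _ (fun p => p.2.2) f5 (x1, (x2, x3)) L5).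
Qed.

Lemma linear_chain_system (L1 : {linear V1 -> 'rV[R]_n1})
    (L2 : {linear V2 -> 'rV[R]_n1}) (L3 : {linear V2 -> 'rV[R]_n2})
    (L4 : {linear V3 -> 'rV[R]_n2}) (L5 : {linear V3 -> 'rV[R]_n3}) :
  linear (chain_system L1 L2 L3 L4 L5).
Proof.
have lin (W : normedModType R) m (h : {linear W -> 'rV[R]_m}) c p q :
    h (c *: p + q) = c *: h p + h q by rewrite linearP.
move=> c p q; rewrite /chain_system/= (lin _ _ L1) (lin _ _ L2).
rewrite (lin _ _ L3) (lin _ _ L4) (lin _ _ L5) !scale_row_mx !add_row_mx.
by congr row_mx; [|congr row_mx]; lmod R.
Qed.

Definition chain_system_linear (L1 : {linear V1 -> 'rV[R]_n1})
    (L2 : {linear V2 -> 'rV[R]_n1}) (L3 : {linear V2 -> 'rV[R]_n2})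
    (L4 : {linear V3 -> 'rV[R]_n2}) (L5 : {linear V3 -> 'rV[R]_n3}) :
    {linear (V1 * (V2 * V3))%type -> 'rV[R]_(n1 + (n2 + n3))} :=
  HB.pack (chain_system L1 L2 L3 L4 L5)
    (GRing.isLinear.Build _ _ _ _ (chain_system L1 L2 L3 L4 L5)
      (linear_chain_system L1 L2 L3 L4 L5)).

End ChainSystem.

(** * First-order solutions and their cost *)
Section LiftedChains.
Context {R : realType} {G : lie_groupoid R} (eta : groupoid_metric G).
Local Notation M := (obj G).
Local Notation g := (eta0 eta).

(** The common part of the two directions: the equations [F p = c u] are solved
    near [v0] by points [p] with velocity [b], and a chart reads off from them
    points of the object manifold, at a cost given by the norm of [K b].  The
    neighbourhood [P] keeps the solutions in the domains of the charts used to
    write the equations. *)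
Lemma lift_chain (V : normedModType R) m (F : V -> 'rV[R]_m) (v0 b : V)
    (L : {linear V -> 'rV[R]_m}) (c : R -> 'rV[R]_m) (t : R) (x : M)
    (X : V -> 'T M) (K : {linear V -> 'T M}) (P : set V) (s r : R) :
  strict_diff F v0 L -> (forall w, exists v, L v = w) ->
  c t = F v0 -> expands c t (L b) ->
  continuous K -> fderiv X v0 K -> X v0 = mchart M x x ->
  nbhs v0 P -> Num.sqrt (g x (K b) (K b)) <= s -> 0 < r ->
  \forall u \near t, exists p, [/\ P p, F p = c u,
    (chain_dist eta x (cinv (mchart M x) (X p)) <= ((s + r) * `|u - t|)%:E)%E &
    (chain_dist eta (cinv (mchart M x) (X p)) x <= ((s + r) * `|u - t|)%:E)%E].
Proof.
move=> FL Lsurj ct cb cK XK X0 Pv0 Ks r0.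
have [d d0 Hd] := chain_dist_chart eta x (K b) r0.
have [k k0 Kk] := linear_lipschitz cK.
have [dP dP0 HP] := near_norm Pv0.
have b10 : 0 < `|b| + 1 by rewrite ltr_wpDl.
have e20 : 0 < d / 2 / (`|b| + 1) by rewrite !divr_gt0.
have [dX dX0 HX] := XK _ e20.
pose e1 := Num.min 1 (d / 2 / k).
have e10 : 0 < e1 by rewrite lt_min ltr01 !divr_gt0.
have small (D : R) : 0 < D -> \forall u \near t, (`|b| + 1) * `|u - t| < D.
  by move=> D0; apply: near_dist_mul => //; exact: ltW.
have SL := strict_lift FL Lsurj ct cb e10.
near=> u.
have [p Fp pb] : exists2 p, F p = c u & `|p - v0 - (u - t) *: b| <= e1 * `|u - t|.
  by near: u; exact: SL.
have pv0 : `|p - v0| <= (`|b| + 1) * `|u - t|.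
  have -> : p - v0 = (p - v0 - (u - t) *: b) + (u - t) *: b by rewrite subrK.
  rewrite (le_trans (ler_normD _ _))// normrZ mulrDl mul1r addrC mulrC lerD2l.
  by apply: le_trans pb _; rewrite ler_piMl// /e1 ge_min lexx.
have pP : `|p - v0| < dP by apply: le_lt_trans pv0 _; near: u; exact: small.
have pX : `|p - v0| < dX by apply: le_lt_trans pv0 _; near: u; exact: small.
have XpX := HX _ pX.
have Xpd : `|X p - mchart M x x| < d.
  rewrite -X0; have -> : X p - X v0 = (X p - X v0 - K (p - v0)) + K (p - v0).
    by rewrite subrK.
  rewrite (le_lt_trans (ler_normD _ _))//.
  apply: le_lt_trans (lerD XpX (Kk _)) _; rewrite -mulrDl.
  apply: le_lt_trans (ler_wpM2l _ pv0) _; first by rewrite addr_ge0// ltW.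
  rewrite -ltr_pdivlMl; last by rewrite addr_gt0.
  near: u; apply: small; rewrite mulr_gt0// invr_gt0 addr_gt0//.
have key : `|X p - mchart M x x - (u - t) *: K b| <= d * `|u - t|.
  rewrite -X0.
  have -> : X p - X v0 - (u - t) *: K b =
      (X p - X v0 - K (p - v0)) + K (p - v0 - (u - t) *: b).
    rewrite [K (_ - (u - t) *: b)]linearB [K (_ *: _)]linearZZ.
    lmod R.
  rewrite (le_trans (ler_normD _ _))//.
  apply: le_trans (lerD XpX (Kk _)) _.
  have h1 : d / 2 / (`|b| + 1) * `|p - v0| <= d / 2 * `|u - t|.
    rewrite -mulrA ler_pM2l ?divr_gt0// ler_pdivrMl//.
  have h2 : k * `|p - v0 - (u - t) *: b| <= d / 2 * `|u - t|.
    rewrite -ler_pdivlMl// mulrA; apply: le_trans pb _; rewrite ler_wpM2r//.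
    by rewrite /e1 ge_min [k^-1 * _]mulrC lexx orbT.
  lra.
have cx : cinv (mchart M x) (mchart M x x) = x.
  by rewrite cfunK// inE; exact: chart_at_dom.
have xd : `|mchart M x x - mchart M x x| < d by rewrite subrr normr0.
have le_s : (((Num.sqrt (g x (K b) (K b)) + r) * `|u - t|)%:E <=
    ((s + r) * `|u - t|)%:E)%E.
  by rewrite lee_fin ler_wpM2r// lerD2r.
exists p; split=> //; first exact: HP.
- by apply: le_trans le_s; have := Hd _ _ _ xd Xpd key; rewrite cx.
- apply: le_trans le_s; rewrite -(normrN (u - t)).
  have key' : `|mchart M x x - X p - (- (u - t)) *: K b| <= d * `|- (u - t)|.
    rewrite normrN; apply: le_trans key; rewrite -normrN.
    have -> // : - (mchart M x x - X p - - (u - t) *: K b) =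
      X p - mchart M x x - (u - t) *: K b by lmod R.
  by have := Hd _ _ _ Xpd xd key'; rewrite cx.
Unshelve. all: by end_near. Qed.

End LiftedChains.

Lemma nbhs_triple (R : realType) (X Y Z : normedModType R) (x : X) (y : Y)
    (z : Z) P Q S :
  nbhs x P -> nbhs y Q -> nbhs z S ->
  nbhs ((x, (y, z)) : (X * (Y * Z))%type : normedModType R)
    [set p | [/\ P p.1, Q p.2.1 & S p.2.2]].
Proof.
move=> nx ny nz; exists (P, Q `*` S); first by split=> //; exists (Q, S).
by move=> [p [q s]] /= [? []].
Qed.

Definition fst_linear (R : realType) (V W : normedModType R) :
    {linear (V * W)%type -> V} :=
  HB.pack (@fst V W)
    (GRing.isLinear.Build R (V * W)%type V *:%R fst (fun _ _ _ => erefl)).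

(** * Curves under a Riemannian Morita map *)
Section MoritaEstimates.
Context {R : realType} {H G : lie_groupoid R}.
Context (etaH : groupoid_metric H) (eta : groupoid_metric G).
Context (f : groupoid_map H G) (fM : riemannian_morita etaH eta f).

Lemma push_curve (e : R -> obj H) t r : smooth_curve e -> 0 < r ->
  \forall u \near t,
    (chain_dist eta (fobj f (e t)) (fobj f (e u)) <=
      ((speed (eta0 etaH) e t + r) * `|u - t|)%:E)%E /\
    (chain_dist eta (fobj f (e u)) (fobj f (e t)) <=
      ((speed (eta0 etaH) e t + r) * `|u - t|)%:E)%E.
Proof.
move=> se r0; set x := fobj f (e t).
have [w vw nw] := push_normal fM (e t) (velocity e t).
have [zeta sz tz] := unit_lift vw.
have [_ cfe ec] := curve_at_map (fobj_mdiff f (e t)) (smooth_curve_at t se).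
have ssrc : smooth_map (@src R G) by have [] := src_submersion G.
have stgt : smooth_map (@tgt R G) by have [] := tgt_submersion G.
have S := smooth_map_strict_at ssrc (src_gunit x).
have T := smooth_map_strict_at stgt (tgt_gunit x).
pose h := mchart (obj G) x; pose k := mchart (arr G) (gunit x).
have k1 : cinv k (k (gunit x)) = gunit x.
  by rewrite cfunK// inE; exact: chart_at_dom.
have near_dom : nbhs (k (gunit x))
    [set p | cdom h (src (cinv k p)) /\ cdom h (tgt (cinv k p))].
  exact: filterI (near_chart_cdom ssrc (src_gunit x))
    (near_chart_cdom stgt (tgt_gunit x)).
have near_fe : \forall u \near t, cdom h (fobj f (e u)).
  apply: cfe; apply: open_nbhs_nbhs; split; first exact: cdom_open.
  exact: chart_at_dom.
have ct : (h \o (fobj f \o e)) t = (h \o @src R G \o cinv k) (k (gunit x)).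
  by rewrite /= k1 src_gunit.
have cb : expands (h \o (fobj f \o e)) t
    (tangent_map (@src R G) (gunit x) zeta) by rewrite sz.
have X0 : (h \o @tgt R G \o cinv k) (k (gunit x)) = h x.
  by rewrite /= k1 tgt_gunit.
have sK : Num.sqrt (eta0 eta x (tangent_map (@tgt R G) (gunit x) zeta)
    (tangent_map (@tgt R G) (gunit x) zeta)) <= speed (eta0 etaH) e t.
  by rewrite tz; apply: ler_wsqrtr.
have LC := lift_chain S (submersion_surj (gunit x) (src_submersion G)) ct cb
  (@rV_linear_continuous R _ _ _) (strict_diff_fderiv T) X0 near_dom sK r0.
apply: filterS2 near_fe LC => u hfe [p [[hs ht] hE d1 d2]].
have sE : src (cinv k p) = fobj f (e u) by exact: chart_inj hE.
have ht' : cinv h (h (tgt (cinv k p))) = tgt (cinv k p) by rewrite cfunK// inE.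
rewrite ht' in d1 d2.
have st := orbit_rel_arrow (cinv k p).
rewrite sE in st; have ts := st; rewrite orbit_rel_sym in ts.
split.
- apply: le_trans (chain_dist_triangle eta _ (tgt (cinv k p)) _) _.
  by rewrite -[leRHS]adde0; apply: leeD d1 _; exact: chain_dist_orbit0.
- apply: le_trans (chain_dist_triangle eta _ (tgt (cinv k p)) _) _.
  by rewrite -[leRHS]add0e; apply: leeD d2; exact: chain_dist_orbit0.
Qed.

(** For a right-hand side [(A, (B, C))], an arrow direction [al] is chosen to
    give [C].  What remains is to find [w] and a direction [zeta] at the unit
    with prescribed source and target images; by [unit_lift] it is enough that
    the two agree modulo the orbit, which is surjectivity on normal spaces. *)
Lemma pull_system_surj (xt : obj H) (a : arr G) : tgt a = fobj f xt ->
  forall q, exists p, chain_system (tangent_map (fobj f) xt)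
    (tangent_map (@src R G) (gunit (fobj f xt)))
    (tangent_map (@tgt R G) (gunit (fobj f xt)))
    (tangent_map (@tgt R G) a) (tangent_map (@src R G) a) p = q.
Proof.
move=> ta q; rewrite -[q]hsubmxK; move: (lsubmx q) (rsubmx q) => A {}q.
rewrite -[q]hsubmxK; move: (lsubmx q) (rsubmx q) => B C.
have [al sal] := submersion_surj a (src_submersion G) C.
pose Y := B + tangent_map (@tgt R G) a al.
have [w wY _] := pull_normal fM xt (Y + A).
have [|zeta sz tz] := @unit_lift _ _ (fobj f xt) (tangent_map (fobj f) xt w - A) Y.
  by rewrite -addrA -opprD [A + Y]addrC.
have sE : tangent_map (fobj f) xt w =
    A + tangent_map (@src R G) (gunit (fobj f xt)) zeta.
  by rewrite sz addrC subrK.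
exists (w, (zeta, al)).
by apply/chain_systemP; split; [exact: sE|exact: tz|exact: sal].
Qed.

(** The system is solved in charts at [xt], at the unit of its image and at [a],
    in a direction whose first component [w] is no longer than the velocity of
    [e]. *)
Lemma pull_curve (e : R -> obj G) t (xt : obj H) (a : arr G) r :
  smooth_curve e -> src a = e t -> tgt a = fobj f xt -> 0 < r ->
  \forall u \near t, exists xu, [/\ orbit_rel (fobj f xu) (e u),
    (chain_dist etaH xt xu <=
      ((speed (eta0 eta) e t + r) * `|u - t|)%:E)%E &
    (chain_dist etaH xu xt <=
      ((speed (eta0 eta) e t + r) * `|u - t|)%:E)%E].
Proof.
move=> se sa ta r0; set z := fobj f xt.
have [al sal nal] := src_lift eta a (velocity e t).
have [w wv nw] := pull_normal fM xt (tangent_map (@tgt R G) a al).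
have [zeta sz tz] := unit_lift wv.
have [_ ce ec] := smooth_curve_at t se.
have ssrc : smooth_map (@src R G) by have [] := src_submersion G.
have stgt : smooth_map (@tgt R G) by have [] := tgt_submersion G.
have sf : smooth_map (fobj f) := fobj_smooth f.
pose hx := mchart (obj H) xt; pose hz := mchart (obj G) z.
pose hy := mchart (obj G) (e t); pose k := mchart (arr G) (gunit z).
pose ka := mchart (arr G) a.
pose df : {linear _ -> _} := tangent_map (fobj f) xt.
pose ds1 : {linear _ -> _} := tangent_map (@src R G) (gunit z).
pose dt1 : {linear _ -> _} := tangent_map (@tgt R G) (gunit z).
pose dta : {linear _ -> _} := tangent_map (@tgt R G) a.
pose dsa : {linear _ -> _} := tangent_map (@src R G) a.
pose V : normedModType R := ('T (obj H) * ('T (arr G) * 'T (arr G)))%type.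
pose v0 : V := (hx xt, (k (gunit z), ka a)).
pose F := chain_system (hz \o fobj f \o cinv hx) (hz \o @src R G \o cinv k)
  (hz \o @tgt R G \o cinv k) (hz \o @tgt R G \o cinv ka)
  (hy \o @src R G \o cinv ka).
pose L := chain_system_linear df ds1 dt1 dta dsa.
have FL : strict_diff F v0 L.
  have S1 := smooth_map_strict_at sf (erefl z).
  have S2 := smooth_map_strict_at ssrc (src_gunit z).
  have S3 := smooth_map_strict_at stgt (tgt_gunit z).
  have S4 := smooth_map_strict_at stgt ta.
  have S5 := smooth_map_strict_at ssrc sa.
  exact: strict_diff_chain_system S1 S2 S3 S4 S5.
have Lsurj : forall w0, exists v, L v = w0 := pull_system_surj ta.
have x1 : cinv hx (hx xt) = xt by rewrite cfunK// inE; exact: chart_at_dom.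
have k1 : cinv k (k (gunit z)) = gunit z.
  by rewrite cfunK// inE; exact: chart_at_dom.
have a1 : cinv ka (ka a) = a by rewrite cfunK// inE; exact: chart_at_dom.
pose c u : 'rV[R]_(mdim (obj G) + (mdim (obj G) + mdim (obj G))) :=
  row_mx 0 (row_mx 0 (hy (e u))).
have ct : c t = F v0.
  apply/esym/chain_systemP; rewrite /= x1 k1 a1 src_gunit tgt_gunit ta sa.
  by rewrite !add0r.
have Lb : L (w, (zeta, al)) = row_mx 0 (row_mx 0 (velocity e t)).
  by apply/chain_systemP; split; rewrite ?add0r; [exact: esym sz|exact: tz|exact: sal].
have cb : expands c t (L (w, (zeta, al))).
  move=> q q0; apply: filterS (ec q q0) => u; rewrite Lb /c.
  rewrite !scale_row_mx !opp_row_mx !add_row_mx !scaler0 !subr0.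
  apply: le_trans; rewrite (le_trans (norm_row_mx _ _))// normr0 add0r.
  by rewrite (le_trans (norm_row_mx _ _))// normr0 add0r.
have near_y : \forall u \near t, cdom hy (e u).
  apply: ce; apply: open_nbhs_nbhs; split; first exact: cdom_open.
  exact: chart_at_dom.
pose P1 (p : 'T (obj H)) := cdom hx (cinv hx p) /\ cdom hz (fobj f (cinv hx p)).
pose P2 (p : 'T (arr G)) :=
  cdom hz (src (cinv k p)) /\ cdom hz (tgt (cinv k p)).
pose P3 (p : 'T (arr G)) :=
  cdom hz (tgt (cinv ka p)) /\ cdom hy (src (cinv ka p)).
pose P (p : V) := [/\ P1 p.1, P2 p.2.1 & P3 p.2.2].
have Pv0 : nbhs v0 P.
  have N1 : nbhs (hx xt) P1.
    apply: filterI (near_chart_cdom sf erefl).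
    have hxt : cdom hx xt := chart_at_dom _ xt.
    by apply: filterS (nbhs_chart hxt) => p; exact: cdom_cinv.
  have N2 : nbhs (k (gunit z)) P2.
    exact: filterI (near_chart_cdom ssrc (src_gunit z))
      (near_chart_cdom stgt (tgt_gunit z)).
  have N3 : nbhs (ka a) P3.
    exact: filterI (near_chart_cdom stgt ta) (near_chart_cdom ssrc sa).
  exact: (nbhs_triple N1 N2 N3).
pose K : {linear V -> 'T (obj H)} := fst_linear _ _.
have cK : continuous K by move=> p; exact: cvg_fst.
have sK : Num.sqrt (eta0 etaH xt (K (w, (zeta, al))) (K (w, (zeta, al)))) <=
    speed (eta0 eta) e t.
  by rewrite ta sa in nal; apply: ler_wsqrtr; exact: le_trans nw nal.
have LC := lift_chain FL Lsurj ct cb cK (linear_fderiv K v0) erefl Pv0 sK r0.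
apply: filterS2 near_y LC => u hyu [p [[[Q1 Q1'] [Q2 Q2'] [Q3 Q3']] Fp d1 d2]].
exists (cinv hx p.1); split=> //.
have [E1 E2 E3] := (chain_systemP _ _ _ _ _ _ _ _ _).1 Fp.
rewrite !add0r in E1 E2.
have e1 : fobj f (cinv hx p.1) = src (cinv k p.2.1).
  exact: chart_inj Q1' Q2 E1.
have e2 : tgt (cinv k p.2.1) = tgt (cinv ka p.2.2).
  exact: chart_inj Q2' Q3 E2.
have e3 : src (cinv ka p.2.2) = e u by exact: chart_inj E3.
rewrite e1; apply: orbit_rel_trans (orbit_rel_arrow (cinv k p.2.1)) _.
by rewrite e2 orbit_rel_sym -e3; exact: orbit_rel_arrow.
Qed.

End MoritaEstimates.

(** * Invariance of the pseudo-distance *)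
Section Invariance.
Context {R : realType} {H G : lie_groupoid R}.
Context (etaH : groupoid_metric H) (eta : groupoid_metric G).
Context (f : groupoid_map H G) (fM : riemannian_morita etaH eta f).

Lemma fobj_orbit x y : orbit_rel x y -> orbit_rel (fobj f x) (fobj f y).
Proof.
move=> /asboolP[a [<- <-]]; rewrite -farr_src -farr_tgt; exact: orbit_rel_arrow.
Qed.

Lemma morita_orbit_inj x y : orbit_rel (fobj f x) (fobj f y) -> orbit_rel x y.
Proof.
have [[[_ [g [fg _ _]]] _ _] _] := fM.
move=> /orbit_classP; rewrite -!orbit_mapE => /(congr1 g); rewrite !fg.
by move/orbit_classP.
Qed.

Lemma morita_orbit_surj y : exists x, orbit_rel (fobj f x) y.
Proof.
have [[[_ [g [_ gf _]]] _ _] _] := fM.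
exists (orbit_repr (g (orbit_class y))); apply/orbit_classP.
by rewrite -orbit_mapE orbit_reprK gf.
Qed.

Lemma chain_dist_push x y :
  (chain_dist eta (fobj f x) (fobj f y) <= chain_dist etaH x y)%E.
Proof.
apply: (@chain_dist_greatest _ _ etaH
  (fun x y => chain_dist eta (fobj f x) (fobj f y))) => {x y}.
- by move=> x y z; exact: chain_dist_triangle.
- by move=> x y /fobj_orbit; exact: chain_dist_orbit0.
apply: (@le_riemannian_dist _ _ (eta0 etaH)
  (fun x y => chain_dist eta (fobj f x) (fobj f y))).
- by move=> x; exact: chain_dist_orbit0 (orbit_rel_refl _).
- by move=> x y z; exact: chain_dist_triangle.
- by move=> e t r se r0; exact: push_curve.
Qed.

Lemma chain_dist_pull x y :
  (chain_dist etaH x y <= chain_dist eta (fobj f x) (fobj f y))%E.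
Proof.
(* [psi] is an arbitrary section on orbits, with no continuity: [pull_curve]
   produces points in the right orbits, which is all that matters *)
have [psi psiE] := choice morita_orbit_surj.
have psi_orbit a b : orbit_rel a b -> orbit_rel (psi a) (psi b).
  move=> ab; apply: morita_orbit_inj; apply: orbit_rel_trans (psiE a) _.
  by apply: orbit_rel_trans ab _; rewrite orbit_rel_sym.
have psiK z : orbit_rel (psi (fobj f z)) z by apply: morita_orbit_inj.
apply: (@le_trans _ _ (chain_dist etaH (psi (fobj f x)) (psi (fobj f y)))).
  by apply: chain_dist_orbit; rewrite orbit_rel_sym.
apply: (@chain_dist_greatest _ _ eta
  (fun x y => chain_dist etaH (psi x) (psi y))) => {x y}.
- by move=> x y z; exact: chain_dist_triangle.
- by move=> x y /psi_orbit; exact: chain_dist_orbit0.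
apply: (@le_riemannian_dist _ _ (eta0 eta)
  (fun x y => chain_dist etaH (psi x) (psi y))).
- by move=> x; exact: chain_dist_orbit0 (orbit_rel_refl _).
- by move=> x y z; exact: chain_dist_triangle.
move=> e t r se r0.
have := psiE (e t); rewrite orbit_rel_sym => /asboolP[a [sa ta]].
apply: filterS (pull_curve fM se sa ta r0) => u [xu [uE d1 d2]].
have xuE : orbit_rel xu (psi (e u)).
  apply: morita_orbit_inj; apply: orbit_rel_trans uE _.
  by rewrite orbit_rel_sym.
split.
- apply: le_trans d1; apply: chain_dist_orbit (orbit_rel_refl _) _.
  by rewrite orbit_rel_sym.
- apply: le_trans d2; apply: chain_dist_orbit (orbit_rel_refl _).
  by rewrite orbit_rel_sym.
Qed.

End Invariance.

Theorem corollary3p10 (R : realType) (Gt G : lie_groupoid R)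
    (etat : groupoid_metric Gt) (eta : groupoid_metric G)
    (phi : groupoid_map Gt G) :
  riemannian_morita etat eta phi ->
  forall x y : obj Gt,
    normal_dist eta (orbit_map phi (orbit_class x)) (orbit_map phi (orbit_class y))
    = normal_dist etat (orbit_class x) (orbit_class y).
Proof.
move=> phiM x y; rewrite !orbit_mapE !normal_distE.
by apply/eqP; rewrite eq_le chain_dist_push//= chain_dist_pull.
Qed.
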